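(* There exists a set of permutation patterns $\mathcal F \subset S_{80}$ such that the sequence $\{C_n(\mathcal F)\}_{n\ge 1}$ is not P-recursive. In particular, the Noonan--Zeilberger conjecture (that $\{C_n(\mathcal F)\}$ is P-recursive for every fixed finite set of patterns $\mathcal F\subset S_k$) is false.
   Context: For $\sigma\in S_n$ and $\omega\in S_k$, $\sigma$ contains the pattern $\omega$ if there is a subset $X\subseteq\{1,\dots,n\}$ with $|X|=k$ such that $\sigma|_X$ has the same relative order as $\omega$; otherwise $\sigma$ avoids $\omega$. For a set of patterns $\mathcal F\subset S_k$, $C_n(\mathcal F)$ is the number of permutations $\sigma\in S_n$ avoiding every $\omega\in\mathcal F$. An integer sequence $\{a_n\}$ is P-recursive if it satisfies a nontrivial linear recurrence $q_0(n)a_n+q_1(n)a_{n-1}+\dots+q_k(n)a_{n-k}=0$ for all sufficiently large $n$, with polynomials $q_i\in\mathbb Z[x]$ not all zero. *)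

(* Defs.v *)
From mathcomp Require Import all_boot all_order all_algebra all_fingroup.
Set Implicit Arguments. Unset Strict Implicit. Unset Printing Implicit Defensive.
Import GRing.Theory Num.Theory.

(* sigma in S_n contains omega in S_k: there is X subset {0..n-1}, |X| = k,
   such that sigma restricted to X has the same relative order as omega.
   X is given by its increasing enumeration f : 'I_k -> 'I_n. *)
Definition contains_pattern (n k : nat) (sigma : 'S_n) (omega : 'S_k) : bool :=
  [exists f : {ffun 'I_k -> 'I_n},
    [forall i : 'I_k, forall j : 'I_k,
      ((i < j)%N ==> (f i < f j)%N) &&
      ((sigma (f i) < sigma (f j))%N == (omega i < omega j)%N)]].

Definition avoids (n k : nat) (sigma : 'S_n) (F : {set 'S_k}) : bool :=
  [forall omega in F, ~~ contains_pattern sigma omega].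

Definition C_count (k : nat) (F : {set 'S_k}) (n : nat) : nat :=
  #|[set sigma : 'S_n | avoids sigma F]|.

Definition P_recursive (a : nat -> int) : Prop :=
  exists (d : nat) (q : 'I_d.+1 -> {poly int}),
    (exists i, q i != 0%R) /\
    exists N : nat, forall n : nat, (N <= n)%N -> (d <= n)%N ->
      (\sum_(i < d.+1) (q i).[Posz n] * a (n - i)%N = 0)%R.

(* Main.v *)
Require Import Defs.
From mathcomp Require Import all_boot all_order all_algebra all_fingroup.
From mathcomp Require Import zify.
From Stdlib Require Import Classical ClassicalEpsilon FunctionalExtensionality PropExtensionality.
Set Implicit Arguments. Unset Strict Implicit. Unset Printing Implicit Defensive.

(** Idea. Good permutations are defined by finitely many forbidden configurations of at most 80
    points. They contain "towers", occurrences of one of four simple permutations of length 7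
    or of its reversal, which are forced to be intervals. A tower is "linked" if certain finite
    configurations occur around it, and a linked tower may not be reversed. Reversing a canonically
    chosen unlinked tower (or the whole permutation if there is no tower) is an involution, so the
    number of good permutations is, modulo 2, the number of models: good permutations with a
    tower and with all towers linked.

    In a model the towers form an increasing chain T_1 < ... < T_N; consecutive towers share an
    upper-left point (a link), and lower-right points (arcs) define an increasing map f from row
    slots to column slots with f(1) = 2 and f(j+1) = f(j) + 1, or f(j) + 2 if T_{j+1} is marked,
    while f preserves marks and the skipped slots are unmarked. Hence the marks are the positions
    1 + r(r+1)/2, and N must be triangular for the last run to be complete. There is exactly one
    model for each r, and its size is an integer quadratic polynomial in r whose values meet
    every residue class modulo 2^K while their gaps tend to infinity. So C_n(F) is odd only at
    isolated values of n meeting all residue classes modulo powers of 2, which no P-recursive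
    sequence allows. *)

(** * 2-adic obstruction to P-recursiveness *)

Lemma nat_prop_least (P : nat -> Prop) :
  (exists n, P n) -> exists n, P n /\ forall m, m < n -> ~ P m.
Proof.
case=> n; elim/ltn_ind: n => n IH Pn.
case: (classic (exists m, m < n /\ P m)) => [[m [mn Pm]]|no]; first exact: IH Pm.
by exists n; split=> // m mn Pm; apply: no; exists m.
Qed.

Section PRecursive.
Import GRing.Theory Num.Theory.
Local Open Scope ring_scope.

Lemma dvdz_horner_sub (q : {poly int}) (x y : int) : (x - y %| q.[x] - q.[y])%Z.
Proof.
have /factor_theorem [r Er] : root (q - q.[y]%:P) y by rewrite /root !hornerE subrr.
have <- : (q - q.[y]%:P).[x] = q.[x] - q.[y] by rewrite !hornerE.
by rewrite Er !hornerE dvdz_mull.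
Qed.

Lemma poly_int_neq0_nat (q : {poly int}) : q != 0 -> exists n : nat, q.[Posz n] != 0.
Proof.
move=> q0; apply: NNPP => no.
have : (size [seq Posz n | n <- iota 0 (size q)] < size q)%N.
  apply: max_poly_roots => //.
  - apply/allP=> _ /mapP [n _ ->]; apply/eqP; apply: NNPP => nz.
    by apply: no; exists n; apply/eqP.
  - by rewrite map_inj_uniq ?iota_uniq // => ? ? [].
by rewrite size_map size_iota ltnn.
Qed.

(* Let [2^v] be the exact power of [2] dividing all values of all coefficients of a recurrence,
   and let [2^(v.+1)] not divide [q_i(m)]. At a time [n = m mod 2^(v.+1)] where [a (n - i)] is the
   only odd term, the recurrence fails modulo [2^(v.+1)]. *)
Lemma isolated_odd_not_P_recursive (a : nat -> int) (S : nat -> Prop) (n0 : nat) :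
  (forall n, (n0 <= n)%N -> (odd `|a n|%N <-> S n)) ->
  (forall d K m N : nat, exists n, [/\ (N <= n)%N, S n, n = m %[mod 2 ^ K] &
     forall n', S n' -> n' <> n -> (n' + d < n)%N \/ (n + d < n')%N]) ->
  ~ P_recursive a.
Proof.
move=> odd_a S_spec [d [q [[i0 qi0] [N rec]]]].
pose P v := exists (i : 'I_d.+1) (n : nat), ~~ (((2 : int) ^+ v.+1) %| (q i).[Posz n])%Z.
have [|v [[i [m nd]] minv]] := @nat_prop_least P.
  have [n qn] := poly_int_neq0_nat qi0.
  (* A nonzero integer [z] is not divisible by [2 ^ (|z| + 1)], since that power exceeds [|z|]. *)
  exists `|(q i0).[Posz n]|%N, i0, n; apply/negP => /dvdn_leq.
  rewrite abszX absz_gt0 => /(_ qn); apply/negP; rewrite -ltnNge.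
  exact: leq_trans (ltn_expl _ _) (leq_pexp2l _ _).
have dvd_v j n : (((2 : int) ^+ v) %| (q j).[Posz n])%Z.
  case: v minv {nd} => [|v] minv; first by rewrite expr0 dvd1z.
  by apply/negPn/negP => nd; apply: (minv v) => //; exists j, n.
(* The requested residue is that of [m - i] modulo [2 ^ v.+1], so [n + i] is congruent to [m]; the
   lower bound keeps all indices in range. *)
have [n [nN Sn nm iso]] := S_spec d v.+1 (m + (2 ^ v.+1 - 1) * i)%N (N + n0 + d)%N.
have id : (i <= d)%N by rewrite -ltnS.
have := rec (n + i)%N ltac:(lia) ltac:(lia).
rewrite (bigD1 i) //= addnK => /eqP; rewrite addr_eq0 => /eqP E.
have dvd_rest : (((2 : int) ^+ v.+1) %|
    \sum_(j < d.+1 | j != i) (q j).[Posz (n + i)] * a (n + i - j)%N)%Z.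
  (* The coefficient supplies [2 ^ v]. The index of the other factor differs from [n] by at most
     [d], so isolation makes that factor even. *)
  apply: rpred_sum => j ji; rewrite exprSr; apply: dvdz_mul => //.
  rewrite dvdzE /= dvdn2; apply/negP.
  have jd : (j <= d)%N by rewrite -ltnS.
  move/odd_a => /(_ ltac:(lia)) /iso.
  have ne : nat_of_ord j <> i by move=> e; move/eqP: ji; apply; apply: val_inj.
  by move=> /(_ ltac:(lia)); lia.
move: dvd_rest; rewrite -rpredN -E => dvd_i.
have {}dvd_i : (((2 : int) ^+ v.+1) %| (q i).[Posz (n + i)])%Z.
  move: dvd_i; rewrite Gauss_dvdzl // coprimezE abszX coprimeXl // coprime2n.
  by apply/odd_a => //; lia.
move/negP: nd; apply.
have sub_dvd : (((2 : int) ^+ v.+1) %| (q i).[Posz (n + i)] - (q i).[Posz m])%Z.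
  apply: dvdz_trans (dvdz_horner_sub _ _ _).
  have e : (n + i = m %[mod 2 ^ v.+1])%N.
    rewrite -modnDml nm modnDml.
    have : (i <= 2 ^ v.+1 * i)%N by rewrite leq_pmull ?expn_gt0.
    rewrite mulnBl mul1n => le_i; rewrite -addnA subnK // addnC mulnC.
    by rewrite modnMDl.
  have -> : (2 : int) ^+ v.+1 = (2 ^ v.+1)%N%:Z by rewrite -natrX natz.
  by rewrite -eqz_mod_dvd; apply/eqP; rewrite !modz_nat e.
by rewrite -(rpredBl _ dvd_i).
Qed.
End PRecursive.

(** * Local rules for towers, links and arcs *)

(* The first tower, a marked tower, an ordinary tower, the last tower. *)
Inductive lab := LS | LB | LA | LZ.

Definition mark (l : lab) : bool := match l with LS | LB => true | _ => false end.

(* Together with their reversals, these are all the simple permutations of length 7 containing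
   both 1234 and 4321. Contracting the towers of a model leaves a union of three increasing
   sequences, which has no 4321, so the towers are the only occurrences of these patterns. *)
Definition tab0 (l : lab) : seq nat :=
  match l with
  | LS => [:: 1; 3; 6; 4; 2; 0; 5]
  | LB => [:: 1; 6; 2; 5; 3; 0; 4]
  | LA => [:: 1; 6; 4; 2; 0; 3; 5]
  | LZ => [:: 2; 6; 3; 1; 4; 0; 5]
  end.

Definition tab (l : lab) (c : bool) : seq nat := if c then rev (tab0 l) else tab0 l.

Definition beta (l : lab) (c : bool) (i : 'I_7) : nat := nth 0 (tab l c) i.

Section Structures.
Variables (I : Type) (R1 R2 : rel I).

Definition pat (l : lab) (c : bool) (b : 'I_7 -> I) : Prop :=
  forall i j, R1 (b i) (b j) = (i < j) /\ R2 (b i) (b j) = (beta l c i < beta l c j).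

Definition bk (l : lab) (b : 'I_7 -> I) : Prop := exists c, pat l c b.

Definition isbk (b : 'I_7 -> I) : Prop := exists l, bk l b.

(* [quad h v p b]: the point [p] lies to the right ([h]) or left ([~~ h]), and above ([v])
   or below ([~~ v]), of all the points of the block [b]. *)
Definition quad (h v : bool) (p : I) (b : 'I_7 -> I) : Prop :=
  isbk b /\ forall i, (if h then R1 (b i) p else R1 p (b i)) &&
                      (if v then R2 (b i) p else R2 p (b i)).

End Structures.

Section Configurations.
Variables (I : Type) (R1 : rel I).
Variables (bk : lab -> ('I_7 -> I) -> Prop) (quad : bool -> bool -> I -> ('I_7 -> I) -> Prop).

Local Notation UL := (quad false true).
Local Notation UR := (quad true true).
Local Notation LL := (quad false false).
Local Notation LR := (quad true false).

Definition below (b b' : 'I_7 -> I) : Prop := (exists l, bk l b) /\ forall i, LL (b i) b'.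

(* Since no point is upper-left of three towers (rule [r_three]), a common upper-left point [w]
   makes [b'] the successor of [b]: adjacency becomes the occurrence of a finite pattern. *)
Definition consec (b b' : 'I_7 -> I) (w : I) : Prop := below b b' /\ UL w b /\ UL w b'.

(** The rules up to [r_link] shape the chain of towers and its links. Those from [r_diag] to
    [r_last] leave only links and arcs as points outside towers. [r_row], [r_col] and [r_xorder]
    allow one arc per row slot and per column slot and fix its place relative to the link. The rest
    force the arc map. *)
Record local_rules : Prop := LocalRules {
  r_interval : forall l b p, bk l b ->
    (exists i, ~~ R1 p (b i) && ~~ R1 (b i) p) \/ (exists h v, quad h v p b);
  r_chain : forall l l' b b', bk l b -> bk l' b' ->
    (forall i, ~~ R1 (b i) (b' i) && ~~ R1 (b' i) (b i)) \/ below b b' \/ below b' b;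
  r_three : forall b1 b2 b3 p, below b1 b2 -> below b2 b3 -> UL p b1 -> UL p b3 -> False;
  r_link : forall b1 b2 p p', below b1 b2 -> UL p b1 -> UL p b2 -> UL p' b1 -> UL p' b2 ->
    ~~ R1 p p';
  r_diag : forall b1 b2 w p, consec b1 b2 w -> UR p b1 -> LL p b2 -> False;
  r_single : forall b1 b2 b3 w w' p, consec b1 b2 w -> consec b2 b3 w' ->
    UR p b1 -> UL p b2 -> LL p b3 -> False;
  r_single_first : forall b1 b2 w p, bk LS b1 -> consec b1 b2 w -> UL p b1 -> LL p b2 -> False;
  r_single_last : forall b1 b2 w p, bk LZ b2 -> consec b1 b2 w -> UR p b1 -> UL p b2 -> False;
  r_first : forall b h p, bk LS b -> quad h false p b -> False;
  r_last : forall b v p, bk LZ b -> quad true v p b -> False;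
  r_row : forall b1 b2 w p p', consec b1 b2 w -> UR p b1 -> LR p b2 -> UR p' b1 -> LR p' b2 ->
    ~~ R1 p p';
  r_col : forall b1 b2 w p p', consec b1 b2 w -> LR p b1 -> LL p b2 -> LR p' b1 -> LL p' b2 ->
    ~~ R1 p p';
  r_xorder : forall b1 b2 w p p', consec b1 b2 w -> UR p b1 -> UL p b2 -> LR p' b1 -> LL p' b2 ->
    R1 p p';
  r_mark : forall b1 b2 b3 b4 w w' p l1 l3, consec b1 b2 w -> consec b3 b4 w' ->
    UR p b1 -> LR p b2 -> LR p b3 -> LL p b4 -> bk l1 b1 -> bk l3 b3 -> mark l1 = mark l3;
  r_start : forall b1 b2 b3 w w' p, bk LS b1 -> consec b1 b2 w -> consec b2 b3 w' ->
    UR p b1 -> LR p b2 -> LL p b3;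
  r_step : forall b1 b2 b3 b4 b5 b6 w1 w2 w4 w5 p p' l2,
    consec b1 b2 w1 -> consec b2 b3 w2 -> consec b4 b5 w4 -> consec b5 b6 w5 ->
    UR p b1 -> LR p b2 -> LR p b4 -> LL p b5 -> UR p' b2 -> LR p' b3 ->
    bk l2 b2 -> mark l2 = false -> LL p' b6;
  r_skip : forall b1 b2 b3 b4 b5 b6 w1 w2 w4 w5 p p' l2 l5,
    consec b1 b2 w1 -> consec b2 b3 w2 -> consec b4 b5 w4 -> consec b5 b6 w5 ->
    UR p b1 -> LR p b2 -> LR p b4 -> LL p b5 -> UR p' b2 -> LR p' b3 ->
    bk l2 b2 -> mark l2 -> bk l5 b5 -> LR p' b6 /\ mark l5 = false;
  r_skip_step : forall b1 b2 b3 b4 b5 b6 b7 w1 w2 w4 w5 w6 p p' l2,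
    consec b1 b2 w1 -> consec b2 b3 w2 -> consec b4 b5 w4 -> consec b5 b6 w5 -> consec b6 b7 w6 ->
    UR p b1 -> LR p b2 -> LR p b4 -> LL p b5 -> UR p' b2 -> LR p' b3 ->
    bk l2 b2 -> mark l2 -> LL p' b7
}.

(** These rules compare heights of single points, which [bk] and [quad] do not express; their
    invariance under a flip therefore needs an argument of its own. *)
Record order_rules (R2 : rel I) : Prop := OrderRules {
  r_mono : forall b b' p p', LR p b -> LR p' b' -> R2 p p' -> R1 p p';
  r_yorder : forall b1 b2 w p p', consec b1 b2 w -> UL p b1 -> LL p b2 -> UR p' b1 -> LR p' b2 ->
    R2 p p'
}.

(* [b] comes after a tower [b1] whose arc [p] lands in the last column slot and which is followed
   by a mark, so that the run of towers starting at that mark needs no outgoing arcs. *)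
Definition excused (b : 'I_7 -> I) : Prop :=
  exists b1 b2 b3 b4 w w' p, consec b1 b2 w /\ bk LB b2 /\ consec b3 b4 w' /\ bk LZ b4 /\
    below b1 b /\ UR p b1 /\ LR p b2 /\ LR p b3 /\ LL p b4.

Definition linked (l : lab) (b : 'I_7 -> I) : Prop :=
  (l = LS \/ exists b0, below b0 b) /\
  (l = LZ \/ exists b1 w, consec b b1 w /\ ((exists p, UR p b /\ LR p b1) \/ excused b)).

End Configurations.

(* [rules_state] is the only rule that distinguishes a tower from its reversal: flipping a tower
   stays in the class exactly when the tower is not linked. *)
Section Rules.
Variables (I : Type) (R1 R2 : rel I).

Record rules : Prop := Rules {
  rules_local : local_rules R1 (bk R1 R2) (quad R1 R2);
  rules_order : order_rules R1 (bk R1 R2) (quad R1 R2) R2;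
  rules_state : forall l b, pat R1 R2 l true b -> linked (bk R1 R2) (quad R1 R2) l b -> False
}.
End Rules.

Definition posR (n : nat) : rel 'I_n := fun u v => u < v.
Definition valR (n : nat) (s : 'S_n) : rel 'I_n := fun u v => s u < s v.
Definition good (n : nat) (s : 'S_n) : Prop := rules (@posR n) (valR s).

(** * The simple permutations used as towers *)

Lemma fun_choice (A B : Type) (R : A -> B -> Prop) :
  (forall x, exists y, R x y) -> exists f, forall x, R x (f x).
Proof.
move=> H; exists (fun x => proj1_sig (constructive_indefinite_description _ (H x))) => x.
exact: (proj2_sig (constructive_indefinite_description _ (H x))).
Qed.

(** The mask [s] selects an interval of the permutation [t]: no point outside separates two selected
    points, in position or in value. *)
Definition interval_test (t : seq nat) (s : seq bool) : bool :=
  all (fun i => all (fun j => all (fun m =>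
    [&& nth false s i, nth false s j & ~~ nth false s m] ==>
      ((i < m) == (j < m)) && ((nth 0 t i < nth 0 t m) == (nth 0 t j < nth 0 t m)))
    (iota 0 7)) (iota 0 7)) (iota 0 7).

(** Simplicity of the eight patterns, by computation over all masks. *)
Lemma tab_simple_bits l c (c0 c1 c2 c3 c4 c5 c6 : bool) :
  interval_test (tab l c) [:: c0; c1; c2; c3; c4; c5; c6] ->
  all id [:: c0; c1; c2; c3; c4; c5; c6] || (count id [:: c0; c1; c2; c3; c4; c5; c6] <= 1).
Proof.
case: c0; case: c1; case: c2; case: c3; case: c4; case: c5; case: c6 => //;
  by case: l; case: c; vm_compute.
Qed.

Lemma mem_iota7 k : k \in iota 0 7 -> k < 7.
Proof. by rewrite mem_iota. Qed.

(** Used with [chi] selecting the points of an occurrence that lie in a given tower. When points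
    outside the tower do not distinguish its points, [chi] is an interval, so the occurrence is
    inside the tower or meets it at most once. *)
Lemma beta_simple l c (chi : pred 'I_7) :
  (forall i j m, chi i -> chi j -> ~~ chi m ->
     (i < m) = (j < m) /\ (beta l c i < beta l c m) = (beta l c j < beta l c m)) ->
  (forall i, chi i) \/ (forall i j, chi i -> chi j -> i = j).
Proof.
move=> H; pose s := mkseq (fun i => chi (inord i)) 7.
have sE (i : 'I_7) : nth false s i = chi i by rewrite nth_mkseq // inord_val.
have : interval_test (tab l c) s.
  apply/allP=> i /mem_iota7 i7; apply/allP=> j /mem_iota7 j7; apply/allP=> m /mem_iota7 m7.
  rewrite -(inordK i7) -(inordK j7) -(inordK m7) !sE; apply/implyP=> /and3P [ci cj cm].
  by have [-> e] := H _ _ _ ci cj cm; move: e; rewrite /beta => ->; rewrite !eqxx.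
rewrite /s /mkseq /= => /tab_simple_bits; rewrite -[[:: _; _; _; _; _; _; _]]/s => /orP [/allP al|cnt].
  by left=> i; rewrite -sE; apply: al; rewrite mem_nth // size_mkseq.
right=> i j ci cj; apply/val_inj/eqP/negPn/negP => ij.
suff : 1 < count id s by rewrite ltnNge cnt.
rewrite count_map -size_filter; apply: (@uniq_leq_size _ [:: val i; val j]).
  by rewrite /= inE ij.
by move=> k; rewrite inE mem_seq1 => /orP [] /eqP ->; rewrite mem_filter [preim _ _ _]/= inord_val ?ci ?cj mem_iota ltn_ord.
Qed.

Definition bot (l : lab) (c : bool) : 'I_7 := inord (index 0 (tab l c)).

Lemma beta_bot l c i : i <> bot l c -> beta l c (bot l c) < beta l c i.
Proof.
move=> ne; have : nat_of_ord i <> index 0 (tab l c).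
  by move=> e; apply: ne; apply: val_inj; rewrite /= inordK -?e.
rewrite /beta /bot; case: i {ne} => i /= i7.
rewrite inordK; last by case: l; case: c.
by case: l; case: c; move: i i7; do 7?[case=> //].
Qed.

Lemma beta_inj l c : injective (beta l c).
Proof.
move=> i j; rewrite /beta => /eqP e; apply: val_inj; apply/eqP; move: e.
have u : uniq (tab l c) by case: l; case: c.
by rewrite nth_uniq //; case: l {u}; case: c.
Qed.

Lemma beta_lt7 l c i : beta l c i < 7.
Proof.
have /all_nthP H : all (fun x => x < 7) (tab l c) by case: l; case: c.
by apply: H; case: l; case: c.
Qed.

Lemma beta_rev l c i : beta l c (rev_ord i) = beta l (~~ c) i.
Proof. by case: i => i i7; rewrite /beta; case: l; case: c; move: i i7; do 7?[case=> //]. Qed.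

(** An occurrence of 4321 in every pattern, found by search; it is what prevents stray occurrences
    in the standard models. *)
Lemma beta_desc4 l c : exists i0 i1 i2 i3 : 'I_7,
  [/\ i0 < i1, i1 < i2, i2 < i3, beta l c i1 < beta l c i0 & 
      beta l c i2 < beta l c i1 /\ beta l c i3 < beta l c i2].
Proof.
have : has (fun i0 => has (fun i1 => has (fun i2 => has (fun i3 =>
   [&& i0 < i1, i1 < i2, i2 < i3, nth 0 (tab l c) i1 < nth 0 (tab l c) i0,
       nth 0 (tab l c) i2 < nth 0 (tab l c) i1 & nth 0 (tab l c) i3 < nth 0 (tab l c) i2])
   (iota 0 7)) (iota 0 7)) (iota 0 7)) (iota 0 7).
  by case: l; case: c; vm_compute.
move=> /hasP [i0 +] /hasP [i1 +] /hasP [i2 +] /hasP [i3 +].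
rewrite !mem_iota => /= h0 h1 h2 h3 /and5P [A B C D /andP [E F]].
by exists (Ordinal h0), (Ordinal h1), (Ordinal h2), (Ordinal h3).
Qed.

Lemma beta_determines l c l' c' :
  (forall i j, (beta l c i < beta l c j) = (beta l' c' i < beta l' c' j)) -> l = l' /\ c = c'.
Proof.
move=> H.
have : all (fun i => all (fun j => (nth 0 (tab l c) i < nth 0 (tab l c) j) ==
    (nth 0 (tab l' c') i < nth 0 (tab l' c') j)) (iota 0 7)) (iota 0 7).
  apply/allP=> i /mem_iota7 i7; apply/allP=> j /mem_iota7 j7.
  by have := H (Ordinal i7) (Ordinal j7); rewrite /beta /= => ->.
by case: l {H}; case: c; case: l'; case: c' => //; vm_compute.
Qed.

Section PatternFacts.
Variables (I : Type) (R1 R2 : rel I).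

Lemma pat_inj l c l' c' (b : 'I_7 -> I) : pat R1 R2 l c b -> pat R1 R2 l' c' b -> l = l' /\ c = c'.
Proof.
by move=> p p'; apply: beta_determines => i j; rewrite -(p i j).2 -(p' i j).2.
Qed.

Lemma bk_inj l l' (b : 'I_7 -> I) : bk R1 R2 l b -> bk R1 R2 l' b -> l = l'.
Proof. by move=> [c p] [c' p']; have [] := pat_inj p p'. Qed.

End PatternFacts.

(** * Compactness: the rules involve at most 80 points *)

Definition pull (I J : Type) (v : I -> J) (R : rel J) : rel I := fun x y => R (v x) (v y).

Section Pullback.
Variables (I J : Type) (v : I -> J) (S1 S2 : rel J).
Local Notation T1 := (pull v S1).
Local Notation T2 := (pull v S2).

Lemma linked_pull l b : linked (bk T1 T2) (quad T1 T2) l b -> linked (bk S1 S2) (quad S1 S2) l (v \o b).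
Proof.
move=> [h1 h2]; split.
  by case: h1 => [->|[b0 h]]; [left | right; exists (v \o b0)].
case: h2 => [->|[b1 [w [c h]]]]; [by left | right].
exists (v \o b1), (v w); split=> //.
case: h => [[p h]|[c1 [c2 [c3 [c4 [w1 [w2 [p h]]]]]]]]; [left; by exists (v p) | right].
by exists (v \o c1), (v \o c2), (v \o c3), (v \o c4), (v w1), (v w2), (v p).
Qed.

(** Rules pass to substructures: each conclusion concerns only points already named, so it is an
    instance of the same rule at the image points. Only [linked] brings existential witnesses, which
    are mapped forward. *)
Lemma rules_pull : rules S1 S2 -> rules T1 T2.
Proof.
move=> [L O X]; split.
- split.
  + exact: (fun l b p => @r_interval _ _ _ _ L l (v \o b) (v p)).
  + exact: (fun l l' b b' => @r_chain _ _ _ _ L l l' (v \o b) (v \o b')).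
  + exact: (fun b1 b2 b3 p => @r_three _ _ _ _ L (v \o b1) (v \o b2) (v \o b3) (v p)).
  + exact: (fun b1 b2 p p' => @r_link _ _ _ _ L (v \o b1) (v \o b2) (v p) (v p')).
  + exact: (fun b1 b2 w p => @r_diag _ _ _ _ L (v \o b1) (v \o b2) (v w) (v p)).
  + exact: (fun b1 b2 b3 w w' p => @r_single _ _ _ _ L (v \o b1) (v \o b2) (v \o b3) (v w) (v w') (v p)).
  + exact: (fun b1 b2 w p => @r_single_first _ _ _ _ L (v \o b1) (v \o b2) (v w) (v p)).
  + exact: (fun b1 b2 w p => @r_single_last _ _ _ _ L (v \o b1) (v \o b2) (v w) (v p)).
  + exact: (fun b h p => @r_first _ _ _ _ L (v \o b) h (v p)).
  + exact: (fun b h p => @r_last _ _ _ _ L (v \o b) h (v p)).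
  + exact: (fun b1 b2 w p p' => @r_row _ _ _ _ L (v \o b1) (v \o b2) (v w) (v p) (v p')).
  + exact: (fun b1 b2 w p p' => @r_col _ _ _ _ L (v \o b1) (v \o b2) (v w) (v p) (v p')).
  + exact: (fun b1 b2 w p p' => @r_xorder _ _ _ _ L (v \o b1) (v \o b2) (v w) (v p) (v p')).
  + exact: (fun b1 b2 b3 b4 w w' p l1 l3 => @r_mark _ _ _ _ L (v \o b1) (v \o b2) (v \o b3) (v \o b4) (v w) (v w') (v p) l1 l3).
  + exact: (fun b1 b2 b3 w w' p => @r_start _ _ _ _ L (v \o b1) (v \o b2) (v \o b3) (v w) (v w') (v p)).
  + exact: (fun b1 b2 b3 b4 b5 b6 w1 w2 w4 w5 p p' l2 => @r_step _ _ _ _ L (v \o b1) (v \o b2) (v \o b3) (v \o b4) (v \o b5) (v \o b6) (v w1) (v w2) (v w4) (v w5) (v p) (v p') l2).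
  + exact: (fun b1 b2 b3 b4 b5 b6 w1 w2 w4 w5 p p' l2 l5 => @r_skip _ _ _ _ L (v \o b1) (v \o b2) (v \o b3) (v \o b4) (v \o b5) (v \o b6) (v w1) (v w2) (v w4) (v w5) (v p) (v p') l2 l5).
  + exact: (fun b1 b2 b3 b4 b5 b6 b7 w1 w2 w4 w5 w6 p p' l2 => @r_skip_step _ _ _ _ L (v \o b1) (v \o b2) (v \o b3) (v \o b4) (v \o b5) (v \o b6) (v \o b7) (v w1) (v w2) (v w4) (v w5) (v w6) (v p) (v p') l2).
- split.
  + exact: (fun b b' p p' => @r_mono _ _ _ _ _ O (v \o b) (v \o b') (v p) (v p')).
  + exact: (fun b1 b2 w p p' => @r_yorder _ _ _ _ _ O (v \o b1) (v \o b2) (v w) (v p) (v p')).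
- by move=> l b /(X l (v \o b)) h /linked_pull.
Qed.

End Pullback.

Section Compactness.
Variables (n : nat) (n80 : 80 <= n).

(** The set of points is padded to exactly 80 elements and then enumerated increasingly. *)
Lemma cover_seq (s : seq 'I_n) : size s <= 80 ->
  exists2 f : 'I_80 -> 'I_n, (forall i j : 'I_80, i < j -> f i < f j) & forall z, z \in s -> exists u, z = f u.
Proof.
move=> s80.
have [A [cA sA]] : exists A : {set 'I_n}, #|A| = 80 /\ [set z in s] \subset A.
  have c0 : #|[set z in s]| <= 80 by rewrite cardsE (leq_trans (card_size s)).
  have [k Ek] : exists k, k + #|[set z in s]| = 80 by exists (80 - #|[set z in s]|); rewrite subnK.
  elim: k [set z in s] Ek {c0} => [|k IH] B EB; first by exists B.
  have /set0Pn [z zB] : ~: B != set0.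
    rewrite -card_gt0; have := cardsC B; rewrite card_ord; lia.
  have [|A [cA sA]] := IH (z |: B).
    by rewrite cardsU1; move: zB; rewrite inE => ->; lia.
  by exists A; split=> //; apply: subset_trans sA; apply: subsetU1.
have iA : size (enum A) = 80 by rewrite -cardE.
have n0 : 0 < n by apply: leq_trans n80.
pose d : 'I_n := Ordinal n0.
exists (fun i => nth d (enum A) i).
  have tr : transitive (fun x y : 'I_n => x < y) by move=> x y z; apply: ltn_trans.
  have srt : sorted (fun x y : 'I_n => x < y) (enum A).
    apply: sorted_filter => //; rewrite -enumT.
    by rewrite -[sorted _ _]/(sorted (relpre val ltn) _) -sorted_map val_enum_ord iota_ltn_sorted.
  by move=> i j ij; apply: (sorted_ltn_nth tr d srt) => //; rewrite inE iA.
move=> z zs; have zA : z \in enum A by rewrite mem_enum (subsetP sA) // inE.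
have iz : index z (enum A) < 80 by rewrite -iA index_mem.
by exists (Ordinal iz); rewrite nth_index.
Qed.

Lemma cover_points (bs : seq ('I_7 -> 'I_n)) (ps : seq 'I_n) : size bs * 7 + size ps <= 80 ->
  exists2 f : 'I_80 -> 'I_n, (forall i j : 'I_80, i < j -> f i < f j) &
    foldr (fun b P => (exists b', b = f \o b') /\ P) True bs /\
    foldr (fun p P => (exists p', p = f p') /\ P) True ps.
Proof.
move=> sz; have [|f f_incr cov] := @cover_seq (flatten [seq codom b | b <- bs] ++ ps).
  rewrite size_cat; have -> // : size (flatten [seq codom b | b <- bs]) = size bs * 7.
  by elim: (bs) => //= b bs' IH; rewrite size_cat IH size_codom card_ord.
exists f => //; split.
  have : forall z, z \in flatten [seq codom b | b <- bs] -> exists u, z = f u.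
    by move=> z zs; apply: cov; rewrite mem_cat zs.
  elim: bs {sz cov} => //= b bs IH cov; split; last first.
    by apply: IH => z zs; apply: cov; rewrite mem_cat zs orbT.
  have H i : exists u, b i = f u by apply: cov; rewrite mem_cat codom_f.
  by have [b' Hb] := fun_choice H; exists b'; apply: functional_extensionality.
have : forall z, z \in ps -> exists u, z = f u.
  by move=> z zs; apply: cov; rewrite mem_cat zs orbT.
elim: ps {sz cov} => //= p ps IH cov; split; first by apply: cov; rewrite mem_head.
by apply: IH => z zs; apply: cov; rewrite inE zs orbT.
Qed.

(** The largest rule, [r_skip_step], names seven towers and seven further points, hence at most 56
    points; every other violation is also visible on 80 points. *)
Lemma rules_compact (S1 S2 : rel 'I_n) :
  (forall f : 'I_80 -> 'I_n, (forall i j : 'I_80, i < j -> f i < f j) -> rules (pull f S1) (pull f S2)) ->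
  rules S1 S2.
Proof.
move=> H; split.
- split.
  + move=> l b p; have [f f_incr [[[b0 ->] _] [[p0 ->] _]]] := @cover_points [:: b] [:: p] isT.
  exact: (@r_interval _ _ _ _ (rules_local (H f f_incr)) l b0 p0).
  + move=> l l' b b'; have [f f_incr [[[b0 ->] [[b'0 ->] _]] _]] := @cover_points [:: b; b'] [::] isT.
  exact: (@r_chain _ _ _ _ (rules_local (H f f_incr)) l l' b0 b'0).
  + move=> b1 b2 b3 p; have [f f_incr [[[b10 ->] [[b20 ->] [[b30 ->] _]]] [[p0 ->] _]]] := @cover_points [:: b1; b2; b3] [:: p] isT.
  exact: (@r_three _ _ _ _ (rules_local (H f f_incr)) b10 b20 b30 p0).
  + move=> b1 b2 p p'; have [f f_incr [[[b10 ->] [[b20 ->] _]] [[p0 ->] [[p'0 ->] _]]]] := @cover_points [:: b1; b2] [:: p; p'] isT.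
  exact: (@r_link _ _ _ _ (rules_local (H f f_incr)) b10 b20 p0 p'0).
  + move=> b1 b2 w p; have [f f_incr [[[b10 ->] [[b20 ->] _]] [[w0 ->] [[p0 ->] _]]]] := @cover_points [:: b1; b2] [:: w; p] isT.
  exact: (@r_diag _ _ _ _ (rules_local (H f f_incr)) b10 b20 w0 p0).
  + move=> b1 b2 b3 w w' p; have [f f_incr [[[b10 ->] [[b20 ->] [[b30 ->] _]]] [[w0 ->] [[w'0 ->] [[p0 ->] _]]]]] := @cover_points [:: b1; b2; b3] [:: w; w'; p] isT.
  exact: (@r_single _ _ _ _ (rules_local (H f f_incr)) b10 b20 b30 w0 w'0 p0).
  + move=> b1 b2 w p; have [f f_incr [[[b10 ->] [[b20 ->] _]] [[w0 ->] [[p0 ->] _]]]] := @cover_points [:: b1; b2] [:: w; p] isT.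
  exact: (@r_single_first _ _ _ _ (rules_local (H f f_incr)) b10 b20 w0 p0).
  + move=> b1 b2 w p; have [f f_incr [[[b10 ->] [[b20 ->] _]] [[w0 ->] [[p0 ->] _]]]] := @cover_points [:: b1; b2] [:: w; p] isT.
  exact: (@r_single_last _ _ _ _ (rules_local (H f f_incr)) b10 b20 w0 p0).
  + move=> b h p; have [f f_incr [[[b0 ->] _] [[p0 ->] _]]] := @cover_points [:: b] [:: p] isT.
  exact: (@r_first _ _ _ _ (rules_local (H f f_incr)) b0 h p0).
  + move=> b h p; have [f f_incr [[[b0 ->] _] [[p0 ->] _]]] := @cover_points [:: b] [:: p] isT.
  exact: (@r_last _ _ _ _ (rules_local (H f f_incr)) b0 h p0).
  + move=> b1 b2 w p p'; have [f f_incr [[[b10 ->] [[b20 ->] _]] [[w0 ->] [[p0 ->] [[p'0 ->] _]]]]] := @cover_points [:: b1; b2] [:: w; p; p'] isT.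
  exact: (@r_row _ _ _ _ (rules_local (H f f_incr)) b10 b20 w0 p0 p'0).
  + move=> b1 b2 w p p'; have [f f_incr [[[b10 ->] [[b20 ->] _]] [[w0 ->] [[p0 ->] [[p'0 ->] _]]]]] := @cover_points [:: b1; b2] [:: w; p; p'] isT.
  exact: (@r_col _ _ _ _ (rules_local (H f f_incr)) b10 b20 w0 p0 p'0).
  + move=> b1 b2 w p p'; have [f f_incr [[[b10 ->] [[b20 ->] _]] [[w0 ->] [[p0 ->] [[p'0 ->] _]]]]] := @cover_points [:: b1; b2] [:: w; p; p'] isT.
  exact: (@r_xorder _ _ _ _ (rules_local (H f f_incr)) b10 b20 w0 p0 p'0).
  + move=> b1 b2 b3 b4 w w' p l1 l3; have [f f_incr [[[b10 ->] [[b20 ->] [[b30 ->] [[b40 ->] _]]]] [[w0 ->] [[w'0 ->] [[p0 ->] _]]]]] := @cover_points [:: b1; b2; b3; b4] [:: w; w'; p] isT.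
  exact: (@r_mark _ _ _ _ (rules_local (H f f_incr)) b10 b20 b30 b40 w0 w'0 p0 l1 l3).
  + move=> b1 b2 b3 w w' p; have [f f_incr [[[b10 ->] [[b20 ->] [[b30 ->] _]]] [[w0 ->] [[w'0 ->] [[p0 ->] _]]]]] := @cover_points [:: b1; b2; b3] [:: w; w'; p] isT.
  exact: (@r_start _ _ _ _ (rules_local (H f f_incr)) b10 b20 b30 w0 w'0 p0).
  + move=> b1 b2 b3 b4 b5 b6 w1 w2 w4 w5 p p' l2; have [f f_incr [[[b10 ->] [[b20 ->] [[b30 ->] [[b40 ->] [[b50 ->] [[b60 ->] _]]]]]] [[w10 ->] [[w20 ->] [[w40 ->] [[w50 ->] [[p0 ->] [[p'0 ->] _]]]]]]]] := @cover_points [:: b1; b2; b3; b4; b5; b6] [:: w1; w2; w4; w5; p; p'] isT.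
  exact: (@r_step _ _ _ _ (rules_local (H f f_incr)) b10 b20 b30 b40 b50 b60 w10 w20 w40 w50 p0 p'0 l2).
  + move=> b1 b2 b3 b4 b5 b6 w1 w2 w4 w5 p p' l2 l5; have [f f_incr [[[b10 ->] [[b20 ->] [[b30 ->] [[b40 ->] [[b50 ->] [[b60 ->] _]]]]]] [[w10 ->] [[w20 ->] [[w40 ->] [[w50 ->] [[p0 ->] [[p'0 ->] _]]]]]]]] := @cover_points [:: b1; b2; b3; b4; b5; b6] [:: w1; w2; w4; w5; p; p'] isT.
  exact: (@r_skip _ _ _ _ (rules_local (H f f_incr)) b10 b20 b30 b40 b50 b60 w10 w20 w40 w50 p0 p'0 l2 l5).
  + move=> b1 b2 b3 b4 b5 b6 b7 w1 w2 w4 w5 w6 p p' l2; have [f f_incr [[[b10 ->] [[b20 ->] [[b30 ->] [[b40 ->] [[b50 ->] [[b60 ->] [[b70 ->] _]]]]]]] [[w10 ->] [[w20 ->] [[w40 ->] [[w50 ->] [[w60 ->] [[p0 ->] [[p'0 ->] _]]]]]]]]] := @cover_points [:: b1; b2; b3; b4; b5; b6; b7] [:: w1; w2; w4; w5; w6; p; p'] isT.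
  exact: (@r_skip_step _ _ _ _ (rules_local (H f f_incr)) b10 b20 b30 b40 b50 b60 b70 w10 w20 w40 w50 w60 p0 p'0 l2).
- split.
  + move=> b b' p p'; have [f f_incr [[[b0 ->] [[b'0 ->] _]] [[p0 ->] [[p'0 ->] _]]]] := @cover_points [:: b; b'] [:: p; p'] isT.
  exact: (@r_mono _ _ _ _ _ (rules_order (H f f_incr)) b0 b'0 p0 p'0).
  + move=> b1 b2 w p p'; have [f f_incr [[[b10 ->] [[b20 ->] _]] [[w0 ->] [[p0 ->] [[p'0 ->] _]]]]] := @cover_points [:: b1; b2] [:: w; p; p'] isT.
  exact: (@r_yorder _ _ _ _ _ (rules_order (H f f_incr)) b10 b20 w0 p0 p'0).
(* The witnesses of [linked] must be covered too: in the largest case seven towers and four further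
   points. *)
- move=> l b pb [h1 h2].
  have tr f f_incr b' := @rules_state _ _ _ (H f f_incr) l b'.
  case: h1 => [ls|[b0 h0]].
    subst l; case: h2 => [//|[b1 [w [c h]]]].
    case: h => [[p h]|[c1 [c2 [c3 [c4 [w1 [w2 [p h]]]]]]]].
    + have [f f_incr [[[b' E] [[b1' E1] _]] [[w' Ew] [[p' Ep] _]]]] :=
        @cover_points [:: b; b1] [:: w; p] isT.
      subst; apply: (tr f f_incr b' pb); split; [by left | right; exists b1', w'; split=> //].
      by left; exists p'.
    have [f f_incr [[[b' E] [[b1' E1] [[c1' F1] [[c2' F2] [[c3' F3] [[c4' F4] _]]]]]]
        [[w' Ew] [[w1' Ew1] [[w2' Ew2] [[p' Ep] _]]]]]] :=
        @cover_points [:: b; b1; c1; c2; c3; c4] [:: w; w1; w2; p] isT.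
    subst; apply: (tr f f_incr b' pb); split; [by left | right; exists b1', w'; split=> //].
    by right; exists c1', c2', c3', c4', w1', w2', p'.
  case: h2 => [lz|[b1 [w [c h]]]].
    have [f f_incr [[[b' E] [[b0' E0] _]] _]] := @cover_points [:: b; b0] [::] isT.
    by subst; apply: (tr f f_incr b' pb); split; [right; exists b0' | left].
  case: h => [[p h]|[c1 [c2 [c3 [c4 [w1 [w2 [p h]]]]]]]].
  + have [f f_incr [[[b' E] [[b0' E0] [[b1' E1] _]]] [[w' Ew] [[p' Ep] _]]]] :=
      @cover_points [:: b; b0; b1] [:: w; p] isT.
    subst; apply: (tr f f_incr b' pb); split; [by right; exists b0' | right; exists b1', w'; split=> //].
    by left; exists p'.
  have [f f_incr [[[b' E] [[b0' E0] [[b1' E1] [[c1' F1] [[c2' F2] [[c3' F3] [[c4' F4] _]]]]]]]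
      [[w' Ew] [[w1' Ew1] [[w2' Ew2] [[p' Ep] _]]]]]] :=
      @cover_points [:: b; b0; b1; c1; c2; c3; c4] [:: w; w1; w2; p] isT.
  subst; apply: (tr f f_incr b' pb); split; [by right; exists b0' | right; exists b1', w'; split=> //].
  by right; exists c1', c2', c3', c4', w1', w2', p'.
Qed.

End Compactness.

Definition asb (P : Prop) : bool := if excluded_middle_informative P then true else false.

Lemma asbP P : reflect P (asb P).
Proof. by rewrite /asb; case: excluded_middle_informative => ?; constructor. Qed.

(** * Standardization and the forbidden patterns of length 80 *)

Section Rank.
Variables (X : finType) (g : X -> nat) (g_inj : injective g).

Lemma rank_bound u : #|[set v | g v < g u]| < #|X|.
Proof.
rewrite -[#|X|]cardsT; apply: proper_card; apply/properP; split; first exact: subsetT.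
by exists u; rewrite ?inE ?ltnn.
Qed.

Definition rank u : 'I_#|X| := Ordinal (rank_bound u).

Lemma rank_ltn u v : (rank u < rank v) = (g u < g v).
Proof.
have mono x y : g x < g y -> rank x < rank y.
  move=> xy; apply: proper_card; apply/properP; split.
    by apply/subsetP => z; rewrite !inE => /ltn_trans; apply.
  by exists x; rewrite !inE ?ltnn.
case: (ltngtP (g u) (g v)) => [/mono -> //|/mono vu|/g_inj ->]; last by rewrite ltnn.
by apply/negbTE; rewrite -leqNgt ltnW.
Qed.

Lemma rank_inj : injective rank.
Proof.
move=> u v e; apply: g_inj; have := rank_ltn u v; have := rank_ltn v u; rewrite e ltnn.
by case: ltngtP.
Qed.

End Rank.

Lemma perm_of_values (k : nat) (g : 'I_k -> nat) : injective g ->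
  exists w : 'S_k, forall i j, (w i < w j) = (g i < g j).
Proof.
move=> gi; pose r := fun u => cast_ord (card_ord k) (rank g u).
have ri : injective r by apply: inj_comp (rank_inj gi); apply: cast_ord_inj.
by exists (perm ri) => i j; rewrite !permE /= -rank_ltn.
Qed.

Definition bad_patterns : {set 'S_80} := [set w | ~~ asb (good w)].

(** From left to right this is compactness applied to the standardized restrictions to 80 points;
    from right to left, the rules are inherited by restrictions. *)
Lemma avoids_bad_patterns (n : nat) (s : 'S_n) : 80 <= n -> avoids s bad_patterns <-> good s.
Proof.
move=> n80; split.
  move=> /forallP av; apply: rules_compact => // f f_incr.
  have fi : injective f.
    move=> i j e; apply: val_inj => /=.
    by case: (ltngtP i j) => // /f_incr; rewrite e ltnn.
  have [|w Hw] := @perm_of_values 80 (fun i => s (f i)).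
    by move=> i j /val_inj /perm_inj /fi.
  have Ef (i j : 'I_80) : (f i < f j) = (i < j).
    case: (ltngtP i j) => [/f_incr //|/f_incr /ltnW|/val_inj ->]; last by rewrite ltnn.
    by rewrite leqNgt => /negbTE.
  have : good w.
    apply/asbP; apply/negPn/negP => bad.
    have := av w; rewrite inE bad /= => /existsP; apply.
    exists (finfun f); apply/forallP => i; apply/forallP => j; rewrite !ffunE Hw eqxx Ef.
    by case: (i < j).
  rewrite /good; have -> : @posR 80 = pull f (@posR n).
    by do 2 apply: functional_extensionality => ?; rewrite /pull /posR Ef.
  have -> // : valR w = pull f (valR s).
  by do 2 apply: functional_extensionality => ?; rewrite /pull /valR Hw.
move=> gs; apply/forallP => w; apply/implyP; rewrite inE => /asbP bad.
apply/negP => /existsP [f Hf]; apply: bad.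
have {}Hf (i j : 'I_80) : (i < j -> f i < f j) /\ (s (f i) < s (f j)) = (w i < w j).
  by move/forallP: Hf => /(_ i) /forallP /(_ j) /andP [/implyP h /eqP]; split.
have Ef (i j : 'I_80) : (f i < f j) = (i < j).
  case: (ltngtP i j) => [/(Hf i j).1 //|/(Hf j i).1 /ltnW|/val_inj ->]; last by rewrite ltnn.
  by rewrite leqNgt => /negbTE.
rewrite /good; have -> : @posR 80 = pull f (@posR n).
  by do 2 apply: functional_extensionality => ?; rewrite /pull /posR Ef.
have -> : valR w = pull f (valR s).
  by do 2 apply: functional_extensionality => ?; rewrite /pull /valR (Hf _ _).2.
exact: rules_pull.
Qed.

(** * Flipping a tower *)

(** Induction on the cardinality, removing one two-element orbit at a time. *)
Lemma odd_card_involution (T : finType) (A : {set T}) (f : T -> T) :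
  {in A, forall x, f x \in A} -> {in A, forall x, f (f x) = x} ->
  odd #|A| = odd #|[set x in A | f x == x]|.
Proof.
have [k] := ubnP #|A|; elim: k A => // k IH A Ak fA ff.
case: (set_0Vmem [set x in A | f x != x]) => [none|[x]].
  congr (odd #|pred_of_set _|); apply/setP => x; rewrite !inE.
  case xA: (x \in A) => //=; apply/esym/negPn/negP => fx.
  by have := in_set0 x; rewrite -none inE xA fx.
rewrite inE => /andP [xA fx].
pose B := A :\ x :\ f x.
have fxA : f x \in A :\ x by rewrite !inE fx fA.
have cB : #|A| = #|B|.+2 by rewrite (cardsD1 x) xA (cardsD1 (f x)) fxA !add1n.
have fB : {in B, forall y, f y \in B}.
  move=> y; rewrite !inE => /and3P [yfx yx yA]; rewrite fA // andbT; apply/andP; split.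
    by apply: contraNneq yx => e; rewrite -[y]ff // e ff.
  by apply: contraNneq yfx => e; rewrite -e ff.
have ffB : {in B, forall y, f (f y) = y}.
  by move=> y; rewrite !inE => /and3P [_ _ yA]; apply: ff.
have Bk : #|B| < k by rewrite cB in Ak; lia.
have -> : [set y in A | f y == y] = [set y in B | f y == y].
  apply/setP => y; rewrite !inE; case: eqP => [fy|_]; last by rewrite !andbF.
  have yx : y != x by apply: contraNneq fx => <-; rewrite fy.
  suff -> : y != f x by rewrite yx.
  by apply: contraNneq yx => e; rewrite -fy e ff.
by rewrite -(IH B Bk fB ffB) cB /= negbK.
Qed.

(** Upward induction gives [i <= g i], downward induction the converse. This shows that an
    occurrence inside a tower is the tower itself, and that order-preserving placements are
    unique. *)
Lemma monotone_ord_id (n : nat) (g : 'I_n -> 'I_n) :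
  (forall i j : 'I_n, i < j -> g i < g j) -> forall i, g i = i.
Proof.
move=> g_incr.
have ge (i : 'I_n) : i <= g i.
  case: i; elim=> // m IH mn; apply: leq_ltn_trans (IH (ltnW mn)) _ => /=.
  by apply: g_incr => /=.
have le k (i : 'I_n) : n - i <= k -> g i <= i.
  elim: k i => [|k IH] i; first by rewrite leqn0 subn_eq0 leqNgt ltn_ord.
  case: (ltnP i.+1 n) => [i1 nk|ni _]; last first.
    by have := ltn_ord (g i); have := ltn_ord i; lia.
  have := IH (Ordinal i1); have := g_incr i (Ordinal i1) (ltnSn _) => /= lt /(_ ltac:(lia)).
  lia.
by move=> i; apply: val_inj; apply/eqP; rewrite eqn_leq ge (le _ _ (leqnn _)).
Qed.

Section Flip.
Variable n : nat.
Implicit Types (s : 'S_n) (b : 'I_7 -> 'I_n).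

(** The reversal of the seven positions of [b]: three transpositions, with the middle position
    fixed. *)
Definition flip_perm b : 'S_n :=
  (tperm (b (inord 0)) (b (inord 6)) * tperm (b (inord 1)) (b (inord 5))
     * tperm (b (inord 2)) (b (inord 4)))%g.

Definition flip s b : 'S_n := (flip_perm b * s)%g.

Lemma flip_perm_in b i : injective b -> flip_perm b (b i) = b (rev_ord i).
Proof.
move=> bi; have E (k : nat) (u : 'I_7) : nat_of_ord u = k -> inord k = u.
  by move=> <-; rewrite inord_val.
have T (x y z : 'I_n) : tperm x y z = if z == x then y else if z == y then x else z.
  by case: tpermP => [->|->|/eqP/negbTE -> /eqP/negbTE ->] //; rewrite eqxx //; case: eqP.
have N u v : u < 7 -> v < 7 -> (b (inord u) == b (inord v)) = (u == v).
  by move=> u7 v7; rewrite (inj_eq bi) -val_eqE /= !inordK.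
have [k Ek] : exists k, nat_of_ord i = k by exists i.
have k7 : k < 7 by rewrite -Ek ltn_ord.
rewrite -(E _ _ Ek) -(E (6 - k) (rev_ord (inord k))) /= ?inordK // /flip_perm !permM.
by move: k k7 {Ek}; do 7?[case=> [_|]] => //; rewrite (T (b (inord 0))) !N //= (T (b (inord 1))) !N //= (T (b (inord 2))) !N.
Qed.

Lemma flip_perm_out b z : (forall i, z <> b i) -> flip_perm b z = z.
Proof.
move=> out; have out' i : b i != z by apply/eqP => e; apply: (out i).
by rewrite /flip_perm !permM !tpermD.
Qed.

Lemma flip_in s b i : injective b -> flip s b (b i) = s (b (rev_ord i)).
Proof. by move=> bi; rewrite permM flip_perm_in. Qed.

Lemma flip_out s b z : (forall i, z <> b i) -> flip s b z = s z.
Proof. by move=> out; rewrite permM flip_perm_out. Qed.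

Lemma in_or_out b z : (exists i, z = b i) \/ (forall i, z <> b i).
Proof.
case: (classic (exists i, z = b i)) => [|no]; [by left | right=> i e].
by apply: no; exists i.
Qed.

Lemma flipK s b : injective b -> flip (flip s b) b = s.
Proof.
move=> bi; apply/permP => z; case: (in_or_out b z) => [[i ->]|out].
  by rewrite !flip_in // rev_ordK.
by rewrite !flip_out.
Qed.

Lemma pat_incr s l c b i j : pat (@posR n) (valR s) l c b -> (b i < b j) = (i < j).
Proof. by move=> p; have [] := p i j. Qed.

Lemma pat_injective s l c b : pat (@posR n) (valR s) l c b -> injective b.
Proof.
move=> p i j e; apply: val_inj => /=.
by case: (ltngtP i j) => //; rewrite -(pat_incr _ _ p) e ltnn.
Qed.

Lemma bk_injective s l b : bk (@posR n) (valR s) l b -> injective b.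
Proof. by case=> c; apply: pat_injective. Qed.

Definition separated s b : Prop := forall p, (forall i, p <> b i) ->
  exists h v, forall i, (if h then b i < p else p < b i) && (if v then s (b i) < s p else s p < s (b i)).

Lemma separated_flip s b : injective b -> separated s b -> separated (flip s b) b.
Proof.
move=> bi sep p out; have [h [v H]] := sep p out; exists h, v => i.
rewrite flip_in // flip_out //; have /andP [-> _] := H i.
by have /andP [_ ->] := H (rev_ord i).
Qed.

(** By simplicity, an occurrence after the flip either lies in [b0], and is then [b0] itself with
    its orientation exchanged, or meets [b0] at most once, and is then unaffected. *)
Lemma pat_flip s l0 c0 b0 l c b : pat (@posR n) (valR s) l0 c0 b0 -> separated s b0 ->
  pat (@posR n) (valR (flip s b0)) l c b ->
  if asb (b = b0) then pat (@posR n) (valR s) l (~~ c) b else pat (@posR n) (valR s) l c b.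
Proof.
move=> p0 sep p; have b0i := pat_injective p0.
pose chi i := [exists j, b i == b0 j].
have out m : ~~ chi m -> forall j, b m <> b0 j.
  by move=> /existsPn H j e; have := H j; rewrite e eqxx.
(* How a point of [b0] compares with an outside point depends neither on the chosen point of [b0]
   nor on the flip. *)
have cmp i j m : chi i -> chi j -> ~~ chi m ->
    (b i < b m) = (b j < b m) /\ (flip s b0 (b i) < flip s b0 (b m)) = (s (b j) < s (b m)).
  move=> /existsP [u /eqP ->] /existsP [w /eqP ->] /out om; rewrite flip_in // flip_out //.
  have [h [v H]] := sep _ om; have /andP [hu _] := H u; have /andP [hw vw] := H w.
  have /andP [_ vu] := H (rev_ord u).
  split; first by move: hu hw; case: (h) => [-> -> //|]; rewrite ![b0 _ < _]ltnNge => /ltnW -> /ltnW ->.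
  by move: vu vw; case: (v) => [-> -> //|]; rewrite ![s (b0 _) < _]ltnNge => /ltnW -> /ltnW ->.
have cmp' i j m : chi i -> chi j -> ~~ chi m ->
    (flip s b0 (b m) < flip s b0 (b i)) = (s (b m) < s (b j)).
  move=> /existsP [u /eqP ->] /existsP [w /eqP ->] /out om; rewrite flip_in // flip_out //.
  have [h [v H]] := sep _ om; have /andP [_ vw] := H w.
  have /andP [_ vu] := H (rev_ord u).
  by move: vu vw; case: (v) => [|-> -> //]; rewrite ![_ < s (b0 _)]ltnNge => /ltnW -> /ltnW ->.
case: (@beta_simple l c chi) => [i j m ci cj cm|all_in|at_most1].
- have [e _] := cmp _ _ _ ci cj cm; have [_ e1] := cmp _ _ _ ci cj cm.
  have [_ e2] := cmp _ _ _ cj cj cm.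
  by rewrite -!(p _ _).2 -(pat_incr i m p) -(pat_incr j m p) e /valR e1 e2.
- have H i : exists j, b i = b0 j by have /existsP [j /eqP] := all_in i; exists j.
  have [g Eg] : exists g, b = b0 \o g.
    by have [g Hg] := fun_choice H; exists g; apply: functional_extensionality.
  have g_id : forall i, g i = i.
    apply: monotone_ord_id => i j ij; rewrite -(pat_incr _ _ p0).
    by have := pat_incr i j p; rewrite Eg /= => ->.
  have {Eg} Eb : b = b0 by rewrite Eg; apply: functional_extensionality => i /=; rewrite g_id.
  have -> : asb (b = b0) by apply/asbP.
  subst b => i j; rewrite (p0 i j).1; split=> //.
  have := (p (rev_ord i) (rev_ord j)).2; rewrite /valR !flip_in // !rev_ordK => ->.
  by rewrite !beta_rev.
have same : pat (@posR n) (valR s) l c b.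
  move=> i j; split; first by rewrite (p i j).1.
  rewrite -(p i j).2 /valR; case ci: (chi i); case cj: (chi j).
  - by rewrite (at_most1 _ _ ci cj) !ltnn.
  - by have [_ ->] := cmp i i j ci ci (negbT cj).
  - by rewrite (cmp' j j i cj cj (negbT ci)).
  by rewrite !flip_out //; apply: out; rewrite ?ci ?cj.
(* The tower [b0] meets itself in more than one point. *)
case: asbP => // Eb; subst b.
have := at_most1 ord0 (rev_ord ord0); have ch i : chi i by apply/existsP; exists i.
by move=> /(_ (ch _) (ch _)) /(congr1 val).
Qed.

Lemma good_separated s l b : good s -> bk (@posR n) (valR s) l b -> separated s b.
Proof.
move=> gs bb p out; have [[i /andP [pb bp]]|[h [v [_ H]]]] := r_interval (rules_local gs) p bb.
  case: (out i); apply: val_inj; move: pb bp; rewrite /posR -!leqNgt => pb bp.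
  by apply/eqP; rewrite eqn_leq pb bp.
by exists h, v => i; have := H i; rewrite /posR /valR.
Qed.

Section FlipGood.
Variables (s : 'S_n) (l0 : lab) (b0 : 'I_7 -> 'I_n).
Hypotheses (gs : good s) (b0_block : bk (@posR n) (valR s) l0 b0).
Local Notation bks := (bk (@posR n) (valR s)).
Local Notation qs := (quad (@posR n) (valR s)).
Local Notation s' := (flip s b0).

Let b0i : injective b0 := bk_injective b0_block.
Let sep : separated s b0 := good_separated gs b0_block.

(** The converse inclusion is the direct one for the flipped permutation, since flipping twice is
    the identity. Equality of predicates permits rewriting inside whole sets of rules. *)
Lemma bk_flip : bk (@posR n) (valR s') = bks.
Proof.
have [c0 p0] := b0_block.
have p0' : pat (@posR n) (valR s') l0 (~~ c0) b0.
  move=> i j; split; first by rewrite (p0 i j).1.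
  by rewrite /valR !flip_in // -[_ < _]/(valR s _ _) (p0 _ _).2 !beta_rev.
have fwd l b : bk (@posR n) (valR s') l b -> bks l b.
  by case=> c p; have := pat_flip p0 sep p; case: ifP => _ q; [exists (~~ c) | exists c].
have bwd l b : bks l b -> bk (@posR n) (valR s') l b.
  case=> c; rewrite -{1}(flipK s b0i) => p.
  have := pat_flip p0' (separated_flip b0i sep) p.
  by case: ifP => _ q; [exists (~~ c) | exists c].
apply: functional_extensionality => l; apply: functional_extensionality => b.
by apply: propositional_extensionality; split; [apply: fwd | apply: bwd].
Qed.

Lemma block_cases l b : bks l b ->
  [\/ b = b0, below bks qs b0 b | below bks qs b b0].
Proof.
move=> bb; have [H|[H|H]] := r_chain (rules_local gs) b0_block bb; last by apply: Or33.
  apply: Or31; apply: functional_extensionality => i; apply: val_inj.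
  have := H i; rewrite /posR -!leqNgt => /andP [h1 h2].
  by apply/eqP; rewrite eqn_leq h1 h2.
by apply: Or32.
Qed.

(** Towers form a chain, so no tower point is upper-left or lower-right of a tower. All points whose
    heights are compared in [order_rules] are off-diagonal in this sense, hence keep their values
    under a flip. *)
Lemma off_diagonal_out h b p : qs h (~~ h) p b -> forall i, p <> b0 i.
Proof.
move=> [[l bb] H] i e; subst p; have H0 := H ord0.
case: (block_cases bb) => [Eb|[_ /(_ i) [_ /(_ ord0)]]|[_ /(_ ord0) [_ /(_ i)]]].
- by have := H i; rewrite Eb /posR ltnn; case: (h).
- by move: H0; rewrite /posR /valR; case: (h) => /=; lia.
by move: H0; rewrite /posR /valR; case: (h) => /=; lia.
Qed.

(** A flip changes only comparisons between two points of [b0], while a quadrant compares a point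
    with a tower that does not contain it. *)
Lemma quad_flip : quad (@posR n) (valR s') = qs.
Proof.
apply: functional_extensionality => h; apply: functional_extensionality => v.
apply: functional_extensionality => p; apply: functional_extensionality => b.
rewrite /quad /isbk bk_flip; apply: propositional_extensionality.
suff E : (exists l, bks l b) ->
   ((forall i, (if h then posR (b i) p else posR p (b i)) &&
              (if v then valR s' (b i) p else valR s' p (b i))) <->
   (forall i, (if h then posR (b i) p else posR p (b i)) &&
              (if v then valR s (b i) p else valR s p (b i)))).
  by split=> -[bb H]; split=> //; apply/(E bb).
move=> [l bb]; case: (in_or_out b0 p) => [[u ->]|out].
  case: (block_cases bb) => [->|[_ blw]|[_ blw]].
  - by split=> /(_ u); case: (h); rewrite /posR ltnn.
  - have out i j : b i <> b0 j.
      by move=> e; have [_ /(_ i)] := blw j; rewrite /posR e ltnn.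
    have V w i : s (b0 w) < s (b i) by have [_ /(_ i) /andP []] := blw w.
    have V' w i : (s (b i) < s (b0 w)) = false by rewrite ltnNge ltnW ?V.
    by split=> H i; have := H i; rewrite /valR flip_in // flip_out // ?V ?V'; case: (v).
  have out i j : b i <> b0 j.
    by move=> e; have [_ /(_ j)] := blw i; rewrite /posR e ltnn.
  have V w i : s (b i) < s (b0 w) by have [_ /(_ w) /andP []] := blw i.
  have V' w i : (s (b0 w) < s (b i)) = false by rewrite ltnNge ltnW ?V.
  by split=> H i; have := H i; rewrite /valR flip_in // flip_out // ?V ?V'; case: (v).
case: (block_cases bb) => [->|[_ blw]|[_ blw]].
- split=> H i; have /andP [hi _] := H i; have /andP [_ vi] := H (rev_ord i); rewrite hi /=.
    by move: vi; rewrite /valR flip_in // flip_out // rev_ordK.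
  by move: vi; rewrite /valR flip_in // flip_out.
- have outb i j : b i <> b0 j.
    by move=> e; have [_ /(_ i)] := blw j; rewrite /posR e ltnn.
  by split=> H i; have := H i; rewrite /valR !flip_out.
have outb i j : b i <> b0 j.
  by move=> e; have [_ /(_ j)] := blw i; rewrite /posR e ltnn.
by split=> H i; have := H i; rewrite /valR !flip_out.
Qed.

(** The local rules depend on the values only through [bk] and [quad]. For [rules_state], the one
    tower whose orientation changes is [b0], which is not linked. *)
Lemma good_flip : ~ linked bks qs l0 b0 -> good s'.
Proof.
move=> unl; split; rewrite ?bk_flip ?quad_flip.
- exact: rules_local gs.
- split=> [b b' p p' q q'|b1 b2 w p p' c q1 q2 q3 q4].
    rewrite /valR !flip_out; [|exact: off_diagonal_out q'|exact: off_diagonal_out q].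
    exact: (r_mono (rules_order gs) q q').
  have := r_yorder (rules_order gs) c q1 q2 q3 q4.
  by rewrite /valR !flip_out //; [exact: off_diagonal_out q4|exact: off_diagonal_out q1].
move=> l b p lk.
have [c0 p0] := b0_block; have := pat_flip p0 sep p; case: asbP => [e q|_ q].
  subst b; have bl : bks l b0 by exists (~~ true).
  by have e := bk_inj b0_block bl; subst l; exact: (unl lk).
exact: (rules_state gs q lk).
Qed.

End FlipGood.
End Flip.

(** * Parity of the number of good permutations *)

Definition pick_prop (T : Type) (P : T -> Prop) : option T :=
  match excluded_middle_informative (exists x, P x) with
  | left ex => Some (proj1_sig (constructive_indefinite_description _ ex))
  | right _ => None
  end.

Variant pick_prop_spec (T : Type) (P : T -> Prop) : option T -> Prop :=
  | PickSome x of P x : pick_prop_spec P (Some x)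
  | PickNone of (forall x, ~ P x) : pick_prop_spec P None.

Lemma pick_propP (T : Type) (P : T -> Prop) : pick_prop_spec P (pick_prop P).
Proof.
rewrite /pick_prop; case: excluded_middle_informative => [ex|no]; constructor.
  exact: (proj2_sig (constructive_indefinite_description _ ex)).
by move=> x Px; apply: no; exists x.
Qed.

Section Parity.
Variable n : nat.
Implicit Types s : 'S_n.

Local Notation bks s := (bk (@posR n) (valR s)).
Local Notation qs s := (quad (@posR n) (valR s)).

Definition has_block s : Prop := exists l b, bks s l b.

Definition unlinked s (b : 'I_7 -> 'I_n) : Prop := exists l, bks s l b /\ ~ linked (bks s) (qs s) l b.

Definition model s : Prop :=
  [/\ good s, has_block s & forall l b, bks s l b -> linked (bks s) (qs s) l b].

(* Each tower pattern is listed with its reversal, so reversing a permutation without towers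
   creates none. *)
Definition reverse s : 'S_n := (perm (@rev_ord_inj n) * s)%g.

Lemma reverseE s z : reverse s z = s (rev_ord z).
Proof. by rewrite permM permE. Qed.

Lemma reverseK : involutive reverse.
Proof. by move=> s; apply/permP => z; rewrite !reverseE rev_ordK. Qed.

Lemma has_block_reverse s : has_block (reverse s) -> has_block s.
Proof.
move=> [l [b [c p]]]; exists l, (fun i => rev_ord (b (rev_ord i))), (~~ c) => i j.
have [p1 _] := p (rev_ord j) (rev_ord i); have [_ p2] := p (rev_ord i) (rev_ord j).
split.
  move: p1; rewrite /posR /=; have := ltn_ord (b (rev_ord i)); have := ltn_ord (b (rev_ord j)).
  by have := ltn_ord i; have := ltn_ord j; lia.
by rewrite -!beta_rev -p2 /valR !reverseE.
Qed.

(** Every rule has a tower among its premises, so all of them hold vacuously. *)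
Lemma no_block_good s : ~ has_block s -> good s.
Proof.
move=> no; have noq h v p b : qs s h v p b -> False by case=> [[l bb] _]; apply: no; exists l, b.
have nobk l b : bks s l b -> False by move=> bb; apply: no; exists l, b.
have nobelow b b' : below (bks s) (qs s) b b' -> False by case=> [[l /nobk]].
have nocons b b' w : consec (bks s) (qs s) b b' w -> False by case=> /nobelow.
split.
- by split; try (by intros; exfalso; eauto).
- by split; try (by intros; exfalso; eauto).
by move=> l b p; case: (nobk l b); exists true.
Qed.

(* [pick_prop] depends only on the predicate, which a flip does not change; hence [step] flips
   back the same tower. *)
Definition step s : 'S_n :=
  if pick_prop (unlinked s) is Some b then flip s b
  else if asb (has_block s) then s else reverse s.

Lemma unlinked_flip s b : good s -> unlinked s b -> unlinked (flip s b) = unlinked s.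
Proof.
move=> gs [l [bb _]]; apply: functional_extensionality => b'.
by rewrite /unlinked (bk_flip gs bb) (quad_flip gs bb).
Qed.

Lemma step_good s : good s -> good (step s).
Proof.
rewrite /step; case: pick_propP => [b [l [bb unl]] gs|_ gs]; first exact: good_flip gs bb unl.
case: asbP => // no; apply: no_block_good; apply: contra_not no; exact: has_block_reverse.
Qed.

Lemma pick_unlinked_no_block s : ~ has_block s -> pick_prop (unlinked s) = None.
Proof.
move=> no; case: pick_propP => // b [l [bb _]].
by case: no; exists l, b.
Qed.

Lemma stepK s : good s -> step (step s) = s.
Proof.
move=> gs; have spec := pick_propP (unlinked s); rewrite {2}/step.
case E: (pick_prop (unlinked s)) spec => [b|] spec.
  have unl : unlinked s b by inversion spec.
  have [l [bb _]] := unl.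
  by rewrite /step (unlinked_flip gs unl) E flipK //; apply: bk_injective bb.
case: asbP => [hb|no]; first by rewrite /step E; case: asbP.
have no' : ~ has_block (reverse s) by apply: contra_not no; apply: has_block_reverse.
by rewrite /step pick_unlinked_no_block //; case: asbP => // _; apply: reverseK.
Qed.

(** A flip changes the value at the first point of its tower, and for [2 <= n] a reversal changes
    the value at position 0. *)
Lemma step_fixed s : 2 <= n -> good s -> step s = s <-> model s.
Proof.
move=> n2 gs; rewrite /step; case: pick_propP => [b [l [bb nl]]|no].
  split=> [e|[_ _ /(_ _ _ bb)] //].
  have := flip_in s ord0 (bk_injective bb); rewrite e => /perm_inj /(bk_injective bb).
  by move=> /(congr1 val).
case: asbP => [hb|nb]; split=> //.
- move=> _; split=> // l b bb; apply: NNPP => nl; apply: (no b); by exists l.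
- move=> e; have n0 : 0 < n by apply: leq_trans n2.
  have := reverseE s (Ordinal n0); rewrite e => /perm_inj /(congr1 val) /=; lia.
by case.
Qed.

Lemma odd_card_good : 2 <= n ->
  odd #|[set s : 'S_n | asb (good s)]| = odd #|[set s : 'S_n | asb (model s)]|.
Proof.
move=> n2; rewrite (@odd_card_involution _ _ step).
- congr (odd #|pred_of_set _|); apply/setP => s; rewrite !inE.
  apply/andP/asbP => [[/asbP gs /eqP]|ms]; first by move/(step_fixed n2 gs).
  have gs : good s by case: ms.
  by split; [apply/asbP | apply/eqP/(step_fixed n2 gs)].
- by move=> s; rewrite !inE => /asbP gs; apply/asbP; apply: step_good.
by move=> s; rewrite !inE => /asbP; apply: stepK.
Qed.

End Parity.

(** * Triangular numbers and the arc map *)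

Fixpoint tri (q : nat) : nat := if q is q'.+1 then tri q' + q else 0.

(* [segment k] is the pair [(q, o)] with [o <= q] and [k = tri q + o]. *)
Fixpoint segment (k : nat) : nat * nat :=
  if k is k'.+1 then
    let: (q, o) := segment k' in if o < q then (q, o.+1) else (q.+1, 0)
  else (0, 0).

Lemma segment_tri q o : o <= q -> segment (tri q + o) = (q, o).
Proof.
elim: q o => [|q IHq]; first by case.
elim=> [_|o IHo oq].
  by rewrite addn0 /= addnS /= IHq // ltnn.
by rewrite addnS [segment _]/= IHo ?oq // ltnW.
Qed.

Lemma segmentP k : exists q o, [/\ o <= q, k = tri q + o & segment k = (q, o)].
Proof.
elim: k => [|k [q [o [oq -> e]]]]; first by exists 0, 0.
case: (ltnP o q) => oq'; first by exists q, o.+1; rewrite -addnS segment_tri.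
exists q.+1, 0; split=> //=; [lia | by rewrite e ltnNge oq'].
Qed.

(* The arc leaving row slot [j] ends in column slot [arc_end j]; the marks are the towers
   [tri q + 1], and [arc_end] maps the run starting at a mark into the next one. *)
Definition arc_end (j : nat) : nat := j + (segment j.-1).1.+1.

Definition marked (j : nat) : bool := (segment j.-1).2 == 0.

Lemma arc_endE q o : o <= q -> arc_end (tri q + o).+1 = (tri q.+1 + o).+1.
Proof. by move=> oq; rewrite /arc_end segment_tri //=; lia. Qed.

Lemma markedE q o : o <= q -> marked (tri q + o).+1 = (o == 0).
Proof. by move=> oq; rewrite /marked segment_tri. Qed.

Lemma arc_gt j : j < arc_end j.
Proof. by rewrite /arc_end; lia. Qed.

(** Inside a run both offsets grow by one. When [j] ends run [q], its image is the last but one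
    tower of run [q + 1], while [j + 1] is marked and is sent to the start of run [q + 2]: one slot
    is skipped. *)
Lemma arc_step j : 0 < j -> arc_end j.+1 = arc_end j + (marked j.+1).+1.
Proof.
case: j => // k _; have [q [o [oq -> _]]] := segmentP k.
case: (ltnP o q) => oq'; first by rewrite -[in X in X = _](addnS (tri q) o) -[in marked _](addnS (tri q) o) !arc_endE ?markedE //=; lia.
have -> : o = q by apply/eqP; rewrite eqn_leq oq oq'.
have E : (tri q + q).+1 = tri q.+1 + 0 by rewrite /=; lia.
by rewrite (arc_endE (leqnn q)) E arc_endE // markedE //=; lia.
Qed.

Lemma marked_arc j : 0 < j -> marked (arc_end j) = marked j.
Proof.
case: j => // k _; have [q [o [oq -> _]]] := segmentP k.
by rewrite arc_endE // !markedE // leqW.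
Qed.

(** The skipped slot is the last one of its run and has a nonzero offset. *)
Lemma marked_skip j : 0 < j -> marked j.+1 -> marked (arc_end j).+1 = false.
Proof.
case: j => // k _; have [q [o [oq -> _]]] := segmentP k.
case: (ltnP o q) => oq'; first by rewrite -addnS markedE.
by move=> _; rewrite arc_endE // -addnS markedE //; lia.
Qed.

Lemma marked_tri q : marked (tri q).+1.
Proof. by rewrite -[tri q]addn0 markedE. Qed.

Lemma markedP j : 0 < j -> marked j -> exists q, j = (tri q).+1.
Proof.
case: j => // k _; have [q [o [oq -> _]]] := segmentP k.
by rewrite markedE // => /eqP ->; exists q; rewrite addn0.
Qed.

(** The arc from the last tower of run [q] ends just before the last tower of run [q + 1]. *)
Lemma arc_tri q : (arc_end (tri q.+1)).+1 = tri q.+2.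
Proof. by rewrite /= [tri q + _]addnS arc_endE //=; lia. Qed.

Lemma unmarked_tri q : marked (tri q.+2) = false.
Proof. by rewrite -[tri q.+2]/(tri q.+1 + q.+2) addnS markedE. Qed.

Lemma arc_mono i j : 0 < i -> i < j -> arc_end i < arc_end j.
Proof.
move=> i0; elim: j => // j IH; rewrite ltnS leq_eqVlt => /orP [/eqP <-|ij].
  by rewrite arc_step //; lia.
by apply: ltn_trans (IH ij) _; rewrite arc_step ?(leq_trans _ ij) //; lia.
Qed.

Lemma tri_double q : (tri q).*2 = q * q.+1.
Proof. by elim: q => //= q IH; rewrite doubleD IH -!muln2; lia. Qed.

Arguments tri : simpl never.

(** * The models *)

Section Model.
Variable r : nat.
(** The [N] towers fill the runs [0] to [r + 1]; the [M] arcs leave the towers of all these runs but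
    the last. *)
Local Notation N := (tri r.+2).
Local Notation M := (tri r.+1).

Local Notation raw_site := ('I_N * 'I_7 + 'I_N.-1 + 'I_M)%type.

(* Towers and their points, links, arcs; the ordinals count from 0, the slots from 1. *)
Definition site : finType := raw_site.

Definition label (s : nat) : lab :=
  if s == 1 then LS else if s == N then LZ else if marked s then LB else LA.

Definition kind (p : raw_site) : nat :=
  match p with inl (inl _) => 0 | inl (inr _) => 1 | inr _ => 2 end.

(** Link [s] joins the towers numbered [s + 1] and [s + 2] when counting from 1. It is left of both,
    in column slot [s], and above both, in row slot [s + 2]. *)
Definition xslot (p : raw_site) : nat :=
  match p with inl (inl (s, _)) => s.+1 | inl (inr s) => s | inr j => arc_end j.+1 end.

Definition yslot (p : raw_site) : nat :=
  match p with inl (inl (s, _)) => s.+1 | inl (inr s) => s.+2 | inr j => j.+1 end.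

(* Slot [i] is the interval from [9 i] to [9 i + 8]: tower [i] occupies the offsets 0 to 6,
   a link the offset 7 and an arc the offset 8. *)
Definition xpos (p : raw_site) : nat :=
  9 * xslot p + match p with inl (inl (_, t)) => val t | inl (inr _) => 7 | inr _ => 8 end.

Definition ypos (p : raw_site) : nat :=
  9 * yslot p +
  match p with inl (inl (s, t)) => beta (label s.+1) false t | inl (inr _) => 7 | inr _ => 8 end.

Definition xrel : rel site := fun p q => xpos p < xpos q.
Definition yrel : rel site := fun p q => ypos p < ypos q.

Definition tower (s : 'I_N) : 'I_7 -> site := fun t => inl (inl (s, t)).

Lemma arc_last : (arc_end M).+1 = N. Proof. exact: arc_tri. Qed.

Lemma M_gt0 : 0 < M. Proof. by rewrite /tri addnS. Qed.

Lemma site_cases (p : site) :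
  [\/ exists s t, p = tower s t,
      [/\ kind p = 1, yslot p = (xslot p).+2, yslot p <= N, xpos p = 9 * xslot p + 7
        & ypos p = 9 * yslot p + 7] |
      [/\ kind p = 2, xslot p = arc_end (yslot p), 0 < yslot p <= M, xslot p < N /\
        xpos p = 9 * xslot p + 8 & ypos p = 9 * yslot p + 8]].
Proof.
case: p => [[[s t]|s]|j]; [apply: Or31; by exists s, t|apply: Or32|apply: Or33]; split=> //=.
  by have := ltn_ord s; rewrite /=; lia.
split=> //; rewrite -[X in _ < X]/N -arc_last.
have := ltn_ord j; rewrite leq_eqVlt => /orP [/eqP ->|jM]; first by rewrite ltnSn.
by apply: leq_trans (arc_mono _ jM) _.
Qed.

Lemma tower_pat (s : 'I_N) : pat xrel yrel (label s.+1) false (tower s).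
Proof. by move=> i j; rewrite /xrel /yrel /xpos /ypos /= !ltn_add2l. Qed.

Lemma tower_bk (s : 'I_N) : bk xrel yrel (label s.+1) (tower s).
Proof. by exists false; apply: tower_pat. Qed.

Lemma tower_separated (s : 'I_N) t t' p : (forall u, p <> tower s u) ->
  [/\ xrel p (tower s t) = xrel p (tower s t'), xrel (tower s t) p = xrel (tower s t') p,
      yrel p (tower s t) = yrel p (tower s t') & yrel (tower s t) p = yrel (tower s t') p].
Proof.
move=> out; have := beta_lt7 (label s.+1) false t; have := beta_lt7 (label s.+1) false t'.
have := ltn_ord t; have := ltn_ord t'; rewrite /xrel /yrel.
case: (site_cases p) => [[s' [u e]]|[_ _ _ -> ->]|[_ _ _ [_ ->] ->]]; try by rewrite /xpos /ypos /=; split; lia.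
subst p; have ne : nat_of_ord s' <> s.
  by move=> /val_inj e; subst s'; apply: (out u).
have := beta_lt7 (label s'.+1) false u; have := ltn_ord u.
by rewrite /xpos /ypos /=; split; lia.
Qed.

(** Links form an increasing sequence, and so do arcs, because [arc_end] is increasing; tower points
    descend only within one tower. *)
Lemma same_kind_increasing p q : xrel p q -> yrel q p -> kind p = kind q ->
  exists s t t', p = tower s t /\ q = tower s t'.
Proof.
rewrite /xrel /yrel.
case: (site_cases p) => [[s [t ->]]|[kp a1 _ -> ->]|[kp a1 /andP [b1 _] [_ ->] ->]];
case: (site_cases q) => [[s' [t' ->]]|[kq a2 _ -> ->]|[kq a2 /andP [b2 _] [_ ->] ->]];
  rewrite ?kp ?kq //; last 2 first.
- by lia.
- move=> h1 h2; have lt : yslot q < yslot p by lia.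
  by have := arc_mono b2 lt; lia.
move=> h1 h2 _; case: (eqVneq s s') => [<-|ne]; first by exists s, t, t'.
move: h1 h2; have := beta_lt7 (label s'.+1) false t'; have := beta_lt7 (label s.+1) false t.
have := ltn_ord t; have := ltn_ord t'.
have : nat_of_ord s <> s' by move=> /val_inj e; rewrite e eqxx in ne.
by rewrite /xpos /ypos /=; lia.
Qed.

(** By simplicity, an occurrence not contained in one tower meets each tower at most once. The
    points of its 4321 then have pairwise distinct kinds, but there are only three kinds. *)
Lemma pat_tower l c b : pat xrel yrel l c b -> exists s : 'I_N, [/\ b = tower s, l = label s.+1 & c = false].
Proof.
move=> p.
case: (classic (exists s, forall i, exists t, b i = tower s t)) => [[s H]|no].
  have [g Eg] : exists g, b = tower s \o g.
    by have [g Hg] := fun_choice H; exists g; apply: functional_extensionality.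
  have g_id : forall i, g i = i.
    apply: monotone_ord_id => i j ij; rewrite -(tower_pat s _ _).1.
    by have := (p i j).1; rewrite Eg /= => ->.
  have {Eg} Eb : b = tower s by rewrite Eg; apply: functional_extensionality => i /=; rewrite g_id.
  by exists s; rewrite Eb in p; have [-> ->] := pat_inj p (tower_pat s).
exfalso.
have sparse s i j : (exists t, b i = tower s t) -> (exists t, b j = tower s t) -> i = j.
  pose chi i := [exists t, b i == tower s t].
  have chiP k : reflect (exists t, b k = tower s t) (chi k).
    by apply: (iffP existsP) => -[t e]; exists t; apply/eqP.
  case: (@beta_simple l c chi) => [u v m /chiP [t et] /chiP [t' et'] /chiP out|al|H].
  - rewrite -!(p _ _).2 -(p u m).1 -(p v m).1 et et'.
    have out' k : b m <> tower s k by move=> e; apply: out; exists k.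
    by have [_ -> _ ->] := tower_separated t t' out'.
  - by case: no; exists s => k; apply/chiP.
  by move=> /chiP ci /chiP cj; apply: H.
have [i0 [i1 [i2 [i3 [a01 a12 a23 d01 [d12 d23]]]]]] := beta_desc4 l c.
have D (i j : 'I_7) : i < j -> beta l c j < beta l c i -> kind (b i) <> kind (b j).
  move=> ij bij /same_kind_increasing; rewrite (p i j).1 (p j i).2 => /(_ ij bij).
  move=> [s [t [t' [e e']]]].
  have := sparse s i j (ex_intro _ _ e) (ex_intro _ _ e') => eij.
  by rewrite eij ltnn in ij.
have K q : kind q < 3 by case: q => [[]|].
have := D _ _ a01 d01; have := D _ _ a12 d12; have := D _ _ a23 d23.
have := D _ _ (ltn_trans a01 a12) (ltn_trans d12 d01).
have := D _ _ (ltn_trans a12 a23) (ltn_trans d23 d12).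
have := D _ _ (ltn_trans (ltn_trans a01 a12) a23) (ltn_trans d23 (ltn_trans d12 d01)).
have := K (b i0); have := K (b i1); have := K (b i2); have := K (b i3); lia.
Qed.

Lemma bk_tower l b : bk xrel yrel l b -> exists s : 'I_N, b = tower s /\ l = label s.+1.
Proof. by case=> c /pat_tower [s [-> -> _]]; exists s. Qed.

Lemma isbk_tower b : isbk xrel yrel b -> exists s, b = tower s.
Proof. by case=> l /bk_tower [s [-> _]]; exists s. Qed.

Lemma bk_towerE l (s : 'I_N) : bk xrel yrel l (tower s) <-> l = label s.+1.
Proof.
split=> [|->]; last exact: tower_bk.
by move=> h; apply: bk_inj h (tower_bk s).
Qed.

(** Turns quadrants into inequalities between slots. The condition on [kind] excludes the points of
    the tower itself, which have no quadrant. *)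
Lemma quad_tower h v p (s : 'I_N) : quad xrel yrel h v p (tower s) <->
  [/\ kind p = 0 -> xslot p <> s.+1, (s < xslot p) = h & (s < yslot p) = v].
Proof.
have b7 t := beta_lt7 (label s.+1) false t.
case: (site_cases p) => [[s' [t ->]]|[kp _ _ xp yp]|[kp _ _ [_ xp] yp]]; last 2 first.
- split=> [[_ H]|[_ <- <-]].
    have := H ord0; have := b7 ord0; rewrite /xrel /yrel xp yp /xpos /ypos /= kp.
    by case: (h); case: (v); split=> //; lia.
  split=> [|u]; first by exists (label s.+1); apply: tower_bk.
  have := b7 u; have := ltn_ord u; rewrite /xrel /yrel xp yp /xpos /ypos /=.
  by case: (ltnP s (xslot p)); case: (ltnP s (yslot p)); lia.
- split=> [[_ H]|[_ <- <-]].
    have := H ord0; have := b7 ord0; rewrite /xrel /yrel xp yp /xpos /ypos /= kp.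
    by case: (h); case: (v); split=> //; lia.
  split=> [|u]; first by exists (label s.+1); apply: tower_bk.
  have := b7 u; have := ltn_ord u; rewrite /xrel /yrel xp yp /xpos /ypos /=.
  by case: (ltnP s (xslot p)); case: (ltnP s (yslot p)); lia.
have b7' := beta_lt7 (label s'.+1) false t; have t7 := ltn_ord t.
split=> [[_ H]|[ne <- <-]].
  have ne : nat_of_ord s' <> s.
    by move=> /val_inj e; have := H t; rewrite e /xrel ltnn; case: (h).
  have := H ord0; have := b7 ord0; rewrite /xrel /yrel /xpos /ypos /=.
  by case: (h); case: (v); split=> //; lia.
split=> [|u]; first by exists (label s.+1); apply: tower_bk.
move: ne => /= /(_ erefl) ne.
have := b7 u; have := ltn_ord u; rewrite /xrel /yrel /xpos /ypos /=.
by case: (ltnP s s'.+1); lia.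
Qed.

Lemma slot_cases (p : site) :
  [\/ [/\ kind p = 0, yslot p = xslot p & 0 < xslot p <= N],
      [/\ kind p = 1, yslot p = (xslot p).+2, yslot p <= N, xpos p = 9 * xslot p + 7
        & ypos p = 9 * yslot p + 7] |
      [/\ kind p = 2, xslot p = arc_end (yslot p), 0 < yslot p <= M, yslot p < xslot p < N /\
        xpos p = 9 * xslot p + 8 & ypos p = 9 * yslot p + 8]].
Proof.
case: (site_cases p) => [[s [t ->]]|H|H]; [apply: Or31|exact: Or32|apply: Or33].
  by split=> //=; rewrite ltn_ord.
by case: H => k e y [lt xp] yp; split=> //; split=> //; rewrite lt e arc_gt.
Qed.

Lemma below_tower (s s' : 'I_N) : below (bk xrel yrel) (quad xrel yrel) (tower s) (tower s') <-> s < s'.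
Proof.
split=> [[_ /(_ ord0) /quad_tower [/= /(_ erefl)]]|lt]; first by lia.
split=> [|i]; first by exists (label s.+1); apply: tower_bk.
by apply/quad_tower; split=> /=; lia.
Qed.

Lemma consec_tower (s s' : 'I_N) w :
  consec (bk xrel yrel) (quad xrel yrel) (tower s) (tower s') w <->
  [/\ nat_of_ord s' = s.+1, kind w = 1 & xslot w = s].
Proof.
rewrite /consec below_tower !quad_tower.
case: (slot_cases w) => [[-> -> _]|[-> yw _ _ _]|[-> xw _ _ _]]; split.
- by move=> [_ [[_ + +] _]]; lia.
- by case.
- by case=> lt [[_ a b] [_ c d]]; split=> //; lia.
- by case=> a _ b; split; [|split; split] => //; lia.
- by have h := arc_gt (yslot w); move=> [_ [[_ a b] [_ c d]]]; lia.
by case.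
Qed.

Lemma mark_label s : 0 < s <= N -> mark (label s) = marked s.
Proof.
rewrite /label => /andP [s0 sN]; case: eqP => [->//|s1].
case: eqP => [->|]; first by rewrite unmarked_tri.
by case: (marked s).
Qed.

Lemma label_first (s : 'I_N) : LS = label s.+1 -> nat_of_ord s = 0.
Proof. by rewrite /label; case: eqP => [[]|_] //; case: eqP => // _; case: marked. Qed.

Lemma label_last (s : 'I_N) : LZ = label s.+1 -> s.+1 = N.
Proof. by rewrite /label; case: eqP => //; case: eqP => // _ _; case: marked. Qed.

Lemma isbk_quad h v p b : quad xrel yrel h v p b -> exists s, b = tower s.
Proof. by case=> /isbk_tower. Qed.

Lemma isbk_below b b' : below (bk xrel yrel) (quad xrel yrel) b b' ->
  (exists s, b = tower s) /\ (exists s, b' = tower s).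
Proof. by case=> /isbk_tower bb /(_ ord0) /isbk_quad bb'. Qed.

Lemma isbk_consec b b' w : consec (bk xrel yrel) (quad xrel yrel) b b' w ->
  (exists s, b = tower s) /\ (exists s, b' = tower s).
Proof. by case=> /isbk_below. Qed.

(** Once all blocks are numbered towers and all relations are inequalities between slots, each rule
    becomes linear arithmetic together with facts on [arc_end] and [marked]. *)
Ltac blocks :=
  repeat match goal with
  | H : consec _ _ ?b _ _ |- _ => is_var b; destruct (proj1 (isbk_consec H)) as [? ->]
  | H : consec _ _ _ ?b _ |- _ => is_var b; destruct (proj2 (isbk_consec H)) as [? ->]
  | H : below _ _ ?b _ |- _ => is_var b; destruct (proj1 (isbk_below H)) as [? ->]
  | H : below _ _ _ ?b |- _ => is_var b; destruct (proj2 (isbk_below H)) as [? ->]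
  | H : quad _ _ _ _ _ ?b |- _ => is_var b; destruct (isbk_quad H) as [? ->]
  end.

Ltac slots :=
  repeat match goal with
  | H : consec _ _ (tower _) (tower _) _ |- _ => move/consec_tower: H => H; case: H => ? ? ?
  | H : below _ _ (tower _) (tower _) |- _ => move/below_tower: H => H
  | H : quad _ _ _ _ _ (tower _) |- _ => move/quad_tower: H => H; case: H => ? ? ?
  | H : bk _ _ _ (tower _) |- _ => move/bk_towerE: H => H
  | H : LS = label _ |- _ => move/label_first: H => H
  | H : LZ = label _ |- _ => move/label_last: H => H
  end.

Ltac sites p := case: (slot_cases p) => [[? ? ?]|[? ? ? ? ?]|[? ? ? [? ?] ?]].

Lemma arc_end1 : arc_end 1 = 2. Proof. by []. Qed.

Lemma local_rules_model : local_rules xrel (bk xrel yrel) (quad xrel yrel).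
Proof.
split.
- move=> l b p /bk_tower [s [-> _]]; case: (classic (kind p = 0 -> xslot p <> s.+1)) => H.
    by right; exists (s < xslot p), (s < yslot p); apply/quad_tower.
  left; case: (site_cases p) H => [[s' [t ->]]|[k _ _ _ _] []|[k _ _ _ _] []]; rewrite ?k //= => H.
  have e : s' = s by apply: val_inj => /=; apply: NNPP => ne; apply: H => _ [].
  by subst s'; exists t; rewrite /xrel !ltnn.
- move=> l l' b b' /bk_tower [s [-> _]] /bk_tower [s' [-> _]].
  case: (ltngtP s s') => [lt|lt|/val_inj ->].
  + by right; left; apply/below_tower.
  + by right; right; apply/below_tower.
  by left=> i; rewrite /xrel !ltnn.
- by intros; blocks; slots; sites p; lia.
- by intros; blocks; slots; rewrite /xrel; sites p; sites p'; lia.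
- by intros; blocks; slots; sites p; lia.
- by intros; blocks; slots; sites p; lia.
- by intros; blocks; slots; sites p; lia.
- by intros; blocks; slots; sites p; lia.
- by intros; blocks; slots; sites p; lia.
- by intros; blocks; slots; sites p; lia.
- intros; blocks; slots; rewrite /xrel; sites p; sites p'; try lia.
  have e : yslot p = yslot p' by lia.
  by have := congr1 arc_end e; lia.
- by intros; blocks; slots; rewrite /xrel; sites p; sites p'; lia.
- by intros; blocks; slots; rewrite /xrel; sites p; sites p'; lia.
- intros; blocks; slots; subst l1 l3; rewrite !mark_label ?ltn_ord //; sites p; try lia.
  match goal with |- marked ?a = marked ?b => have e : yslot p = a by lia end.
  rewrite -e -marked_arc; last by lia.
  by congr marked; lia.
- intros; blocks; slots; apply/quad_tower; sites p; try lia.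
  have e : yslot p = 1 by lia.
  by have := congr1 arc_end e; rewrite arc_end1; split; lia.
- intros; blocks; slots; apply/quad_tower; subst l2.
  match goal with H : mark _ = false |- _ => rewrite mark_label ?ltn_ord // in H; rename H into m0 end.
  sites p; sites p'; try lia.
  have e : yslot p' = (yslot p).+1 by lia.
  have m : marked (yslot p).+1 = false by apply: (etrans _ m0); congr marked; lia.
  have := arc_step (j := yslot p); rewrite m => st.
  by have := congr1 arc_end e; split; lia.
- intros; blocks; slots; rewrite quad_tower; subst l2 l5.
  match goal with H : is_true (mark _) |- _ => rewrite mark_label ?ltn_ord // in H; rename H into m0 end.
  rewrite mark_label ?ltn_ord //.
  sites p; sites p'; try lia.
  have e : yslot p' = (yslot p).+1 by lia.
  have m : marked (yslot p).+1 by apply: (etrans _ m0); congr marked; lia.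
  have := arc_step (j := yslot p); rewrite m => st.
  have := congr1 arc_end e => e'; split; first by split; lia.
  rewrite -(marked_skip _ m); [congr marked|]; lia.
- intros; blocks; slots; rewrite quad_tower; subst l2.
  match goal with H : is_true (mark _) |- _ => rewrite mark_label ?ltn_ord // in H; rename H into m0 end.
  sites p; sites p'; try lia.
  have e : yslot p' = (yslot p).+1 by lia.
  have m : marked (yslot p).+1 by apply: (etrans _ m0); congr marked; lia.
  have := arc_step (j := yslot p); rewrite m => st.
  by have := congr1 arc_end e; split; lia.
Qed.

Lemma order_rules_model : order_rules xrel (bk xrel yrel) (quad xrel yrel) yrel.
Proof.
split.
- intros; blocks; slots; move: H1; rewrite /xrel /yrel; sites p; sites p'; try lia.
  move=> lt; have := arc_mono (i := yslot p) (j := yslot p'); lia.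
- by intros; blocks; slots; rewrite /yrel; sites p; sites p'; lia.
Qed.

Lemma rules_model : rules xrel yrel.
Proof.
split; [exact: local_rules_model | exact: order_rules_model|].
by move=> l b /pat_tower [s [_ _]].
Qed.

(** Towers up to [M] have an outgoing arc. Those of the last run, except its final tower, are
    excused by the arc from [M], which ends in column slot [N - 1] and whose tower is followed by
    the mark [M + 1]. *)
Lemma linked_model l b : bk xrel yrel l b -> linked (bk xrel yrel) (quad xrel yrel) l b.
Proof.
move=> /bk_tower [s [-> ->]]; have sN := ltn_ord s.
have N2 : 1 < N by rewrite -arc_last; have := arc_gt M; have := M_gt0; lia.
split.
  case: (posnP s) => [s0|s0]; first by left; rewrite /label s0.
  right; exists (tower (Ordinal (ltnW N2))); exact/below_tower.
case: (eqVneq s.+1 N) => [sl|sl]; first by left; rewrite /label sl eqxx; case: eqP => //; lia.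
have s1 : s.+1 < N by lia.
have s2 : s < N.-1 by lia.
right; exists (tower (Ordinal s1)), (inl (inr (Ordinal s2))); split; first exact/consec_tower.
have iA (j : nat) : 0 < j <= M -> exists p : site, [/\ kind p = 2, xslot p = arc_end j & yslot p = j].
  move=> /andP [j0 jM]; have j1 : j.-1 < M by lia.
  by exists (inr (Ordinal j1)); rewrite /= prednK.
have [sM|sM] := leqP s.+1 M.
  left; have [p [kp xp yp]] := iA s.+1 ltac:(lia).
  by exists p; split; apply/quad_tower; have := arc_gt s.+1; rewrite kp xp yp; split=> //=; lia.
right; have M0 := M_gt0; have aM := arc_gt M; have aN := arc_last.
have iT k : 0 < k <= N -> exists s : 'I_N, s.+1 = k.
  move=> /andP [k0 kN]; have k1 : k.-1 < N by lia.
  by exists (Ordinal k1); rewrite /= prednK.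
have iW k : 0 < k < N -> exists p : site, [/\ kind p = 1 & xslot p = k.-1].
  move=> /andP [k0 kN]; have k1 : k.-1 < N.-1 by lia.
  by exists (inl (inr (Ordinal k1))).
have [t1 e1] := iT M ltac:(lia); have [t2 e2] := iT M.+1 ltac:(lia).
have [t3 e3] := iT N.-1 ltac:(lia); have [t4 e4] := iT N ltac:(lia).
have [w1 [kw1 xw1]] := iW M ltac:(lia); have [w3 [kw3 xw3]] := iW N.-1 ltac:(lia).
have [p [kp xp yp]] := iA M ltac:(lia).
exists (tower t1), (tower t2), (tower t3), (tower t4), w1, w3, p.
rewrite !consec_tower !bk_towerE below_tower !quad_tower kp xp yp.
do ?split=> //; try lia.
  rewrite e2 /label; case: eqP => [|_]; first by lia.
  case: eqP => [|_]; first by lia.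
  by rewrite marked_tri.
by rewrite e4 /label eqxx; case: eqP => //; lia.
Qed.

Lemma xpos_inj : injective xpos.
Proof.
move=> p q; have big := ltn_ord; rewrite /xpos.
case: p => [[[s t]|s]|j]; case: q => [[[s' t']|s']|j'] /=;
  try (by have := ltn_ord t; have := ltn_ord t'; lia);
  try (by have := ltn_ord t; lia); try (by have := ltn_ord t'; lia); try lia.
- have := ltn_ord t; have := ltn_ord t' => h1 h2 e.
  have e1 : s = s' by apply: val_inj => /=; lia.
  have e2 : t = t' by apply: val_inj => /=; lia.
  by rewrite e1 e2.
- by move=> e; congr (inl (inr _)); apply: val_inj => /=; lia.
move=> e; congr inr; apply: val_inj => /=.
have := arc_mono (i := j.+1) (j := j'.+1); have := arc_mono (i := j'.+1) (j := j.+1); lia.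
Qed.

Lemma ypos_inj : injective ypos.
Proof.
move=> p q; rewrite /ypos; have b7 s t := beta_lt7 (label s) false t.
case: p => [[[s t]|s]|j]; case: q => [[[s' t']|s']|j'] /=;
  try (by have := b7 s.+1 t; lia); try (by have := b7 s'.+1 t'; lia); try lia.
- have := b7 s.+1 t; have := b7 s'.+1 t' => h1 h2 e.
  have e1 : s = s' by apply: val_inj => /=; lia.
  subst s'; have /beta_inj -> // : beta (label s.+1) false t = beta (label s.+1) false t' by lia.
- by move=> e; congr (inl (inr _)); apply: val_inj => /=; lia.
by move=> e; congr inr; apply: val_inj => /=; lia.
Qed.

Lemma card_site : #|site| = N * 7 + N.-1 + M.
Proof. by rewrite !card_sum card_prod !card_ord. Qed.

End Model.

(** The permutation is drawn by the points of [X] with coordinates [x] and [y], of which only the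
    relative order matters. *)
Definition layout (n : nat) (s : 'S_n) (X : finType) (x y : X -> nat) (e : X -> 'I_n) : Prop :=
  [/\ bijective e, forall u v, (e u < e v) = (x u < x v) & forall u v, (s (e u) < s (e v)) = (y u < y v)].

Lemma layout_exists (X : finType) (x y : X -> nat) : injective x -> injective y ->
  exists (s : 'S_#|X|) (e : X -> 'I_#|X|), layout s x y e.
Proof.
move=> xi yi; have [g Kg gK] : bijective (rank x).
  by apply: inj_card_bij (rank_inj xi) _; rewrite card_ord.
have fi : injective (fun u => rank y (g u)) by apply: inj_comp (rank_inj yi) (can_inj gK).
exists (perm fi), (rank x); split=> [|u v|u v]; first by exists g.
  exact: rank_ltn.
by rewrite !permE !Kg rank_ltn.
Qed.

(** Comparing positions shows that both placements agree; comparing values then gives equal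
    permutations. Both steps rest on [monotone_ord_id]. *)
Lemma layout_unique (n : nat) (s s' : 'S_n) (X : finType) (x y : X -> nat) (e e' : X -> 'I_n) :
  layout s x y e -> layout s' x y e' -> s = s'.
Proof.
move=> [[g Kg gK] ex ey] [[g' Kg' gK'] ex' ey'].
have ee' u : e' u = e u.
  have := @monotone_ord_id n (fun i => e' (g i)) _ (e u); rewrite Kg; apply=> i j ij.
  by rewrite ex' -ex !gK.
apply/permP => z; rewrite -[z in LHS]gK.
have := @monotone_ord_id n (fun i => s' (e' (g (s^-1 i)%g))) _ (s (e (g z))).
rewrite permK ee' Kg gK => -> // i j ij.
by rewrite ey' -ey !gK !permKV.
Qed.

Lemma model_of_layout (r n : nat) (s : 'S_n) (e : site r -> 'I_n) :
  layout s (@xpos r) (@ypos r) e -> model s.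
Proof.
move=> [[g Kg gK] ex ey].
have Ex : pull g (@xrel r) = @posR n.
  by do 2 apply: functional_extensionality => ?; rewrite /pull /xrel -ex !gK.
have Ey : pull g (@yrel r) = valR s.
  by do 2 apply: functional_extensionality => ?; rewrite /pull /yrel -ey !gK.
have Ex' : @xrel r = pull e (@posR n).
  by do 2 apply: functional_extensionality => ?; rewrite /pull /posR ex.
have Ey' : @yrel r = pull e (valR s).
  by do 2 apply: functional_extensionality => ?; rewrite /pull /valR ey.
have gb l b : bk (@posR n) (valR s) l b -> bk (@xrel r) (@yrel r) l (g \o b).
  by rewrite -Ex -Ey.
split.
- by rewrite /good -Ex -Ey; apply/rules_pull/rules_model.
- have N0 : 0 < tri r.+2 by rewrite /tri addnS.
  exists (label r 1), (e \o @tower r (Ordinal N0)).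
  by have := tower_bk (Ordinal N0); rewrite Ex' Ey'.
move=> l b bb; have := linked_model (gb _ _ bb); rewrite Ex' Ey' => /linked_pull.
have -> // : e \o (g \o b) = b by apply: functional_extensionality => i /=; rewrite gK.
Qed.

Lemma model_exists (r : nat) : exists s : 'S_#|site r|, model s.
Proof.
have [s [e le]] := layout_exists (@xpos_inj r) (@ypos_inj r).
by exists s; apply: model_of_layout le.
Qed.

(** * Every model is one of the standard ones *)

(** Serves to describe the towers to the left of a point, or below it, by one number. *)
Lemma threshold (P : nat -> Prop) (N : nat) :
  (forall i j, 0 < i -> i < j -> j <= N -> P j -> P i) ->
  exists X, X <= N /\ forall i, 0 < i <= N -> P i <-> i <= X.
Proof.
elim: N => [|N IH] down; first by exists 0; split=> // i; lia.
case: (classic (P N.+1)) => PN.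
  exists N.+1; split=> // i iN; case: (ltngtP i N.+1) => // [lt|gt|->]; [|by lia|by split].
  by split=> // _; apply: down PN; lia.
have [|X [XN H]] := IH; first by move=> i j i0 ij jN; apply: down => //; apply: leqW.
exists X; split=> [|i iN]; first exact: leqW.
case: (ltngtP i N.+1) => // [lt|gt|->]; [by apply: H; lia|by lia|].
by split=> // ?; lia.
Qed.

Section Model.
Variables (n : nat) (s : 'S_n).
Hypothesis ms : model s.
Local Notation bks := (bk (@posR n) (valR s)).
Local Notation qs := (quad (@posR n) (valR s)).
Local Notation blw := (below bks qs).
Local Notation csc := (consec bks qs).

Let gs : good s. Proof. by case: ms. Qed.
Let loc := rules_local gs.
Let lnk l b : bks l b -> linked bks qs l b. Proof. by case: ms => _ _; apply. Qed.

Lemma below_lt b b' i j : blw b b' -> b i < b' j /\ s (b i) < s (b' j).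
Proof. by case=> _ /(_ i) [_ /(_ j) /andP []]. Qed.

Lemma below_asym b b' : blw b b' -> blw b' b -> False.
Proof. by move=> /(below_lt ord0 ord0) [h _] /(below_lt ord0 ord0) []; lia. Qed.

Lemma below_quad b b' i : blw b b' -> qs true true (b' i) b.
Proof.
move=> bb; split; first by case: bb.
by move=> j; rewrite /posR /valR; have [-> ->] := below_lt j i bb.
Qed.

Lemma towers_exist : exists N (T : nat -> 'I_7 -> 'I_n) (lam : nat -> lab),
  [/\ 0 < N, forall i, 0 < i <= N -> bks (lam i) (T i),
      forall l b, bks l b -> exists2 i, 0 < i <= N & b = T i &
      forall i j, 0 < i -> i < j -> j <= N -> blw (T i) (T j)].
Proof.
have [_ [l0 [b0 bb0]] _] := ms.
pose B := enum [set f : {ffun 'I_7 -> 'I_n} | asb (isbk (@posR n) (valR s) f)].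
pose le (f g : {ffun 'I_7 -> 'I_n}) := f ord0 <= g ord0.
have le_tr : transitive le by move=> f g h; apply: leq_trans.
have le_total : total le by move=> f g; apply: leq_total.
pose S := sort le B; have S_sorted : sorted le S by apply: sort_sorted.
have memS b : isbk (@posR n) (valR s) b -> finfun b \in S.
  move=> bb; rewrite mem_sort mem_enum inE; apply/asbP.
  by have -> : (finfun b : 'I_7 -> 'I_n) = b by apply: functional_extensionality => i; rewrite ffunE.
have blkS f : f \in S -> isbk (@posR n) (valR s) f.
  by rewrite mem_sort mem_enum inE => /asbP.
(* Numbering starts at 1, whence the shift; only indices from 1 to [size S] matter. *)
pose T i := (nth (finfun b0) S i.-1 : 'I_7 -> 'I_n).
have TP i : 0 < i <= size S -> isbk (@posR n) (valR s) (T i).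
  by move=> iS; apply: blkS; apply: mem_nth; move: iS; move: (size S) => k; lia.
exists (size S), T, (fun i => match excluded_middle_informative (isbk (@posR n) (valR s) (T i)) with
  | left h => proj1_sig (constructive_indefinite_description _ h) | right _ => LS end); split.
- by have := memS b0 (ex_intro (fun l => bks l b0) l0 bb0); case: (S).
- move=> i iS; case: excluded_middle_informative => [h|]; last by have := TP i iS.
  exact: (proj2_sig (constructive_indefinite_description _ h)).
- move=> l b bb; have bS := memS b (ex_intro (fun l => bks l b) l bb).
  exists (index (finfun b) S).+1; first by rewrite /= index_mem.
  by rewrite /T /= nth_index //; apply: functional_extensionality => i; rewrite ffunE.
move=> i j i0 ij jS.
have hi : i.-1 < size S by move: (size S) jS => k; lia.
have hj : j.-1 < size S by move: (size S) jS => k; lia.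
have [li bi] := TP i ltac:(lia); have [lj bj] := TP j ltac:(lia).
have lij : T i ord0 <= T j ord0.
  by apply: (sorted_leq_nth le_tr _ (finfun b0) S_sorted); rewrite ?inE //; [move=> f; apply: leqnn|lia].
case: (block_cases gs bi bj) => [e|//|/(below_lt ord0 ord0) []]; last by lia.
have : nth (finfun b0) S i.-1 = nth (finfun b0) S j.-1.
  by apply/ffunP => k; have := congr1 (fun f => f k) e; rewrite /T => ->.
have u : uniq S by rewrite sort_uniq enum_uniq.
by move/eqP; rewrite (nth_uniq _ hi hj u); lia.
Qed.

(** * The chain of towers and the slots of a point *)

Section Towers.
Variables (N : nat) (T : nat -> 'I_7 -> 'I_n) (lam : nat -> lab).
Hypotheses (N_gt0 : 0 < N)
  (T_bk : forall i, 0 < i <= N -> bks (lam i) (T i))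
  (bk_T : forall l b, bks l b -> exists2 i, 0 < i <= N & b = T i)
  (T_below : forall i j, 0 < i -> i < j -> j <= N -> blw (T i) (T j)).

Lemma T_bkE l i : 0 < i <= N -> bks l (T i) -> l = lam i.
Proof. by move=> iN h; apply: bk_inj h (T_bk iN). Qed.

Lemma T_belowE i j : 0 < i <= N -> 0 < j <= N -> blw (T i) (T j) -> i < j.
Proof.
move=> iN jN h; case: (ltngtP i j) => // [ji|e].
  by have := below_asym h (T_below _ ji _); case; lia.
by move: h; rewrite e => h; have := below_asym h h.
Qed.

Lemma T_inj i j : 0 < i <= N -> 0 < j <= N -> T i = T j -> i = j.
Proof.
move=> iN jN e; case: (ltngtP i j) => // lt.
  by have h := T_below (i := i) (j := j) ltac:(lia) lt ltac:(lia); rewrite e in h; case: (below_asym h h).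
by have h := T_below (i := j) (j := i) ltac:(lia) lt ltac:(lia); rewrite e in h; case: (below_asym h h).
Qed.

Lemma isbk_T b : isbk (@posR n) (valR s) b -> exists2 i, 0 < i <= N & b = T i.
Proof. by case=> l; apply: bk_T. Qed.

(** The first tower has no predecessor, so being linked leaves only the label [LS]. *)
Lemma lam_first : lam 1 = LS.
Proof.
have [[//|[b0 h]] _] := lnk (T_bk (i := 1) N_gt0).
have [i iN e] := isbk_T (proj1 h); subst b0.
by have := T_belowE iN _ h; lia.
Qed.

(** The points of the first tower lie below tower [i], which [r_first] forbids for the label
    [LS]. *)
Lemma lam_not_first i : 1 < i <= N -> lam i <> LS.
Proof.
move=> iN e; have b1 := T_bk (i := i) ltac:(lia); rewrite e in b1.
have [_ H] := T_below (i := 1) (j := i) ltac:(lia) ltac:(lia) ltac:(lia).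
exact: (r_first loc b1 (H ord0)).
Qed.

Lemma lam_last : lam N = LZ.
Proof.
have [_ [//|[b1 [w [[h _] _]]]]] := lnk (T_bk (i := N) ltac:(lia)).
have [i iN e] := isbk_T (proj1 (proj2 h ord0)); subst b1.
by have := T_belowE _ iN h; lia.
Qed.

Lemma lam_not_last i : 0 < i < N -> lam i <> LZ.
Proof.
move=> iN e; have b1 := T_bk (i := i) ltac:(lia); rewrite e in b1.
have h := T_below (i := i) (j := N) ltac:(lia) ltac:(lia) ltac:(lia).
exact: (r_last loc b1 (below_quad ord0 h)).
Qed.

Lemma N_gt1 : 1 < N.
Proof.
have [//|N1|N1] := ltngtP 1 N; first by lia.
by have := lam_last; rewrite -N1 lam_first.
Qed.

Lemma quad_inj h v h' v' p b : qs h v p b -> qs h' v' p b -> h = h' /\ v = v'.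
Proof.
move=> [_ /(_ ord0) H] [_ /(_ ord0)]; move: H; rewrite /posR /valR.
by case: h; case: h'; case: v; case: v' => //; lia.
Qed.

Lemma consec_index i j w : 0 < i <= N -> 0 < j <= N -> csc (T i) (T j) w -> j = i.+1.
Proof.
move=> iN jN [h [w1 w2]]; have ij := T_belowE iN jN h.
case: (ltngtP i.+1 j) => // lt; last by lia.
case: (r_three loc (T_below (i := i) (j := i.+1) _ _ _) (T_below (i := i.+1) (j := j) _ _ _) w1 w2); lia.
Qed.

Lemma consec_T b b' w : csc b b' w -> exists i, [/\ 0 < i < N, b = T i & b' = T i.+1].
Proof.
move=> c; have [i iN e] := isbk_T (proj1 (proj1 (proj2 c))).
have [j jN e'] := isbk_T (proj1 (proj2 (proj2 c))); subst b b'.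
have E := consec_index iN jN c; subst j.
by exists i; split=> //; lia.
Qed.

(* [X] towers lie to the left of [p], and [Y] towers below it. *)
Definition slots (p : 'I_n) (X Y : nat) : Prop :=
  [/\ X <= N, Y <= N & forall i, 0 < i <= N -> qs (i <= X) (i <= Y) p (T i)].

Lemma slots_exist p : (forall i t, 0 < i <= N -> p <> T i t) -> exists X Y, slots p X Y.
Proof.
move=> loose.
have Q i : 0 < i <= N -> exists h v, qs h v p (T i).
  move=> iN; have [[t /andP [h1 h2]]|//] := r_interval loc p (T_bk iN).
  by case: (loose i t iN); apply: val_inj; move: h1 h2; rewrite /posR /=; lia.
have [|X [XN HX]] := @threshold (fun i => exists v, qs true v p (T i)) N.
  move=> i j i0 ij jN [v [_ /(_ ord0)]]; rewrite /posR => /andP [h _].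
  have [h' [v' q]] := Q i ltac:(lia); case: h' q => q; first by exists v'.
  have [lt _] := below_lt ord0 ord0 (T_below i0 ij jN).
  by case: q => _ /(_ ord0); rewrite /posR => /andP [] /=; lia.
have [|Y [YN HY]] := @threshold (fun i => exists h, qs h true p (T i)) N.
  move=> i j i0 ij jN [v [_ /(_ ord0)]]; rewrite /valR => /andP [_ h].
  have [h' [v' q]] := Q i ltac:(lia); case: v' q => q; first by exists h'.
  have [_ lt] := below_lt ord0 ord0 (T_below i0 ij jN).
  by case: q => _ /(_ ord0); rewrite /valR => /andP [_] /=; lia.
exists X, Y; split=> // i iN; have [h [v q]] := Q i iN.
have -> : (i <= X) = h.
  apply/idP/idP => [/(HX i iN) [v' q']|hh]; first by have [<- _] := quad_inj q' q.
  by apply/(HX i iN); exists v; rewrite hh in q.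
have -> // : (i <= Y) = v.
apply/idP/idP => [/(HY i iN) [h' q']|hh]; first by have [_ <-] := quad_inj q' q.
by apply/(HY i iN); exists h; rewrite hh in q.
Qed.

Lemma off_diagonal_loose h p b : qs h (~~ h) p b -> forall i t, 0 < i <= N -> p <> T i t.
Proof. by move=> q i t iN; apply: (off_diagonal_out gs (T_bk iN) q). Qed.

Lemma successor i : 0 < i < N -> exists w, csc (T i) (T i.+1) w /\
  ((exists p, qs true true p (T i) /\ qs true false p (T i.+1)) \/ excused bks qs (T i)).
Proof.
move=> iN; have [_ [e|[b1 [w [c h]]]]] := lnk (T_bk (i := i) ltac:(lia)).
  by case: (lam_not_last iN).
have [j [jN e1 e2]] := consec_T c.
have E : i = j by apply: T_inj e1; lia.
by subst b1 j; exists w.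
Qed.

(** * Classification of the points outside towers *)

Section Arcs.
Variable W : nat -> 'I_n.
Hypothesis W_consec : forall i, 0 < i < N -> csc (T i) (T i.+1) (W i).

Lemma slots_fun p X Y X' Y' : slots p X Y -> slots p X' Y' -> X = X' /\ Y = Y'.
Proof.
move=> [XN YN H] [XN' YN' H'].
have E i : 0 < i <= N -> (i <= X) = (i <= X') /\ (i <= Y) = (i <= Y').
  by move=> iN; exact: quad_inj (H i iN) (H' i iN).
split; apply/eqP; rewrite eqn_leq; apply/andP; split.
- by case: (posnP X) => [->//|X0]; rewrite -(E X _).1 //; lia.
- by case: (posnP X') => [->//|X0]; rewrite (E X' _).1 //; lia.
- by case: (posnP Y) => [->//|Y0]; rewrite -(E Y _).2 //; lia.
by case: (posnP Y') => [->//|Y0]; rewrite (E Y' _).2 //; lia.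
Qed.

Lemma slots_quad p X Y i h v : slots p X Y -> 0 < i <= N -> (i <= X) = h -> (i <= Y) = v ->
  qs h v p (T i).
Proof. by move=> [_ _ H] iN <- <-; apply: H. Qed.

Lemma not_lt_eq (p q : 'I_n) : ~~ posR p q -> ~~ posR q p -> p = q.
Proof. by rewrite /posR => h1 h2; apply: val_inj => /=; lia. Qed.

(** By [r_three], a link is upper-left of no towers other than the two it joins. *)
Lemma W_slots i : 0 < i < N -> slots (W i) i.-1 i.+1.
Proof.
move=> iN; have [_ [w1 w2]] := W_consec iN.
have [X [Y sl]] := slots_exist (off_diagonal_loose (h := false) w1).
have [XN YN H] := sl.
have [hX hY] := quad_inj (H i ltac:(lia)) w1.
have [hX' hY'] := quad_inj (H i.+1 ltac:(lia)) w2.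
suff [<- <-] : X = i.-1 /\ Y = i.+1 by [].
have low j : 0 < j -> j < i -> j <= X.
  move=> j0 ji; rewrite leqNgt; apply/negP => Xj.
  apply: (r_three loc (T_below (i := j) (j := i) j0 ji ltac:(lia))
      (T_below (i := i) (j := i.+1) ltac:(lia) ltac:(lia) ltac:(lia)) (p := W i)) => //.
  by apply: (slots_quad sl); lia.
have high j : i.+1 < j <= N -> Y < j.
  move=> /andP [ij jN]; rewrite ltnNge; apply/negP => jY.
  apply: (r_three loc (T_below (i := i) (j := i.+1) ltac:(lia) ltac:(lia) ltac:(lia))
      (T_below (i := i.+1) (j := j) ltac:(lia) ij jN) (p := W i)) => //.
  by apply: (slots_quad sl); lia.
split; first by case: (posnP i.-1) => [|i0]; [|have := low i.-1]; lia.
have := high i.+2; lia.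
Qed.

(* [p] is an arc from row slot [j] to column slot [i]. *)
Definition is_arc (i j : nat) (p : 'I_n) : Prop := [/\ 0 < j, j < i, i < N & slots p i j].

(** The point is upper-left of exactly the towers [i] with [X < i <= Y], so the sign and size of
    [Y - X] decide its nature. *)
Lemma slots_cases p X Y : slots p X Y -> (exists2 i, 0 < i < N & p = W i) \/ is_arc X Y p.
Proof.
move=> sl; have [XN YN H] := sl; have N1 := N_gt1.
have Q := slots_quad sl.
have first h : ~ qs h false p (T 1).
  by move=> q; apply: (r_first loc _ q); rewrite -lam_first; apply: T_bk; lia.
have last v : ~ qs true v p (T N).
  by move=> q; apply: (r_last loc _ q); rewrite -lam_last; apply: T_bk; lia.
case: (ltngtP X Y) => [XY|YX|e].
- have Y3 : Y <= X.+2.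
    rewrite leqNgt; apply/negP => lt.
    apply: (r_three loc (T_below (i := X.+1) (j := X.+2) ltac:(lia) ltac:(lia) ltac:(lia))
      (T_below (i := X.+2) (j := X.+3) ltac:(lia) ltac:(lia) ltac:(lia)) (p := p)); apply: Q; lia.
  have [Y2|Y1] : Y = X.+2 \/ Y = X.+1 by lia.
    left; exists X.+1; first by lia.
    have [b [w1 w2]] := W_consec (i := X.+1) ltac:(lia).
    have q1 : qs false true p (T X.+1) by apply: Q; lia.
    have q2 : qs false true p (T X.+2) by apply: Q; lia.
    by apply: not_lt_eq; [apply: (r_link loc b q1 q2 w1 w2) | apply: (r_link loc b w1 w2 q1 q2)].
  (* Upper-left of a single tower: the three [r_single] rules treat the first, the inner and the
     last tower. *)
  exfalso; case: (posnP X) => [X0|X0].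
    subst X; have b1 := T_bk (i := 1) N_gt0; rewrite lam_first in b1.
    apply: (r_single_first loc b1 (W_consec (i := 1) ltac:(lia)) (p := p)); apply: Q; lia.
  have [XL|XL] := ltnP X.+1 N.
    apply: (r_single loc (W_consec (i := X) ltac:(lia)) (W_consec (i := X.+1) ltac:(lia)) (p := p));
      apply: Q; lia.
  have EN : N = X.+1 by lia.
  have b1 := T_bk (i := X.+1) ltac:(lia); rewrite -EN lam_last EN in b1.
  apply: (r_single_last loc b1 (W_consec (i := X) ltac:(lia)) (p := p)); apply: Q; lia.
(* Below the diagonal lies an arc; [r_first] excludes row slot 0 and [r_last] excludes column slot
   [N]. *)
- right; split=> //.
    by case: (posnP Y) => // Y0; case: (first true); apply: Q; lia.
  by rewrite ltn_neqAle XN andbT; apply/eqP => XN'; case: (last false); apply: Q; lia.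
exfalso; subst Y; case: (posnP X) => [X0|X0].
  by apply: (first false); apply: Q; lia.
have [XL|XL] := ltnP X N; last by apply: (last true); apply: Q; lia.
apply: (r_diag loc (W_consec (i := X) ltac:(lia)) (p := p)); apply: Q; lia.
Qed.

Lemma point_cases p : [\/ exists i t, 0 < i <= N /\ p = T i t, exists2 i, 0 < i < N & p = W i |
  exists i j, is_arc i j p].
Proof.
case: (classic (exists i t, 0 < i <= N /\ p = T i t)) => [|no]; first exact: Or31.
have [|X [Y sl]] := @slots_exist p.
  by move=> i t iN e; apply: no; exists i, t.
by case: (slots_cases sl) => h; [apply: Or32 | apply: Or33; exists X, Y].
Qed.

Lemma arc_row i i' j p p' : is_arc i j p -> is_arc i' j p' -> p = p'.
Proof.
move=> [j0 ji iN sl] [_ ji' iN' sl']; have c := W_consec (i := j) ltac:(lia).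
have Q := slots_quad sl; have Q' := slots_quad sl'.
by apply: not_lt_eq; apply: (r_row loc c); first [apply: Q | apply: Q']; lia.
Qed.

Lemma arc_col i j j' p p' : is_arc i j p -> is_arc i j' p' -> p = p'.
Proof.
move=> [j0 ji iN sl] [j0' ji' _ sl']; have c := W_consec (i := i) ltac:(lia).
have Q := slots_quad sl; have Q' := slots_quad sl'.
by apply: not_lt_eq; apply: (r_col loc c); first [apply: Q | apply: Q']; lia.
Qed.

Lemma arc_point i j i' j' p : is_arc i j p -> is_arc i' j' p -> i = i' /\ j = j'.
Proof. by move=> [_ _ _ sl] [_ _ _ sl']; exact: slots_fun sl sl'. Qed.

Lemma quad_between h h' p p' b : qs h false p b -> qs h' true p' b -> s p < s p'.
Proof.
move=> [_ /(_ ord0)] + [_ /(_ ord0)]; rewrite /valR => /andP [_ h1] /andP [_ h2].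
exact: ltn_trans h1 h2.
Qed.

(** Tower [j'] separates the two arcs vertically, so [r_mono] orders them horizontally; a common
    column slot is excluded by [arc_col]. *)
Lemma arcs_increasing i j i' j' p p' : is_arc i j p -> is_arc i' j' p' -> j < j' -> i < i'.
Proof.
move=> A A' jj; have [j0 ji iN sl] := A; have [j0' ji' iN' sl'] := A'.
have Q := slots_quad sl; have Q' := slots_quad sl'.
have lt : s p < s p'.
  by apply: (@quad_between (j' <= i) true p p' (T j')); [apply: Q | apply: Q']; lia.
have q : qs true false p (T i) by apply: Q; lia.
have q' : qs true false p' (T i') by apply: Q'; lia.
have pp : p < p' := r_mono (rules_order gs) q q' lt.
case: (ltngtP i i') => // [lt'|e]; last first.
  by subst i'; have e := arc_col A A'; subst p'; rewrite ltnn in pp.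
have [_ /(_ ord0) /andP [h1 _]] : qs false false p' (T i'.+1) by apply: Q'; lia.
have [_ /(_ ord0) /andP [h2 _]] : qs true false p (T i) by [].
have := T_below (i := i'.+1) (j := i).
have [lt2|e2] : i'.+1 < i \/ i'.+1 = i by lia.
  move=> /(_ ltac:(lia) lt2 ltac:(lia)) /(below_lt ord0 ord0) [].
  by move: h1 h2; rewrite /posR; lia.
by move: h1 h2; rewrite e2 /posR; lia.
Qed.

Lemma arc_of_row j p : 0 < j < N -> qs true true p (T j) -> qs true false p (T j.+1) ->
  exists i, is_arc i j p.
Proof.
move=> jN q1 q2; have [X [Y sl]] := slots_exist (off_diagonal_loose (h := true) q2).
have [XN YN H] := sl.
have [hX hY] := quad_inj (H j ltac:(lia)) q1.
have [hX' hY'] := quad_inj (H j.+1 ltac:(lia)) q2.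
have EY : Y = j by lia.
case: (slots_cases sl) => [[k kN e]|]; last by rewrite EY; exists X.
by subst p; have [] := slots_fun sl (W_slots kN); lia.
Qed.

(** Tower [N - 1] has no room for an arc, so it is excused, which yields the arc into column slot
    [N - 1]. By [arc_col] every excuse uses this same arc, so all excused towers come after [i0]. *)
Lemma last_arc : exists i0 p0, [/\ is_arc N.-1 i0 p0, lam i0.+1 = LB &
  forall j, 0 < j < N -> i0 < j \/ exists i p, is_arc i j p].
Proof.
have N1 := N_gt1.
have exc j : 0 < j < N -> (exists i p, is_arc i j p) \/
    exists i0 p0, [/\ i0 < j, is_arc N.-1 i0 p0 & lam i0.+1 = LB].
  move=> jN; have [w [_ [[p [q1 q2]]|]]] := successor jN.
    by left; have [i A] := arc_of_row jN q1 q2; exists i, p.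
  case=> b1 [b2 [b3 [b4 [w1 [w3 [p [c1 [B2 [c3 [Z4 [lt [q1 [q2 [q3 q4]]]]]]]]]]]]]]; right.
  have [i0 [i0N e1 e2]] := consec_T c1; have [k [kN e3 e4]] := consec_T c3; subst b1 b2 b3 b4.
  have EB := T_bkE (i := i0.+1) ltac:(lia) B2.
  have EZ := T_bkE (i := k.+1) ltac:(lia) Z4.
  have kN1 : k.+1 = N.
    by apply: NNPP => ne; apply: (lam_not_last (i := k.+1)); [lia | rewrite EZ].
  have ij := T_belowE (i := i0) (j := j) ltac:(lia) ltac:(lia) lt.
  have [i A] := arc_of_row i0N q1 q2; have [_ _ _ [_ _ H]] := A.
  have [h1 _] := quad_inj (H k ltac:(lia)) q3.
  have [h2 _] := quad_inj (H k.+1 ltac:(lia)) q4.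
  have Ei : i = N.-1 by lia.
  by exists i0, p; split; rewrite -?Ei.
have [[i [p [_ ]]]|[i0 [p0 [lt A E]]]] := exc N.-1 ltac:(lia); first by lia.
exists i0, p0; split=> // j jN; case: (exc j jN) => [|[i1 [p1 [lt1 A1 _]]]]; [by right | left].
have e := arc_col A A1; subst p1.
by have [_ ->] := arc_point A A1.
Qed.

(** * The arc map and the labels are forced *)

Section ArcFunction.
Variables (i0 : nat) (F : nat -> nat) (P : nat -> 'I_n).
Hypotheses (P_arc : forall j, 0 < j <= i0 -> is_arc (F j) j (P j))
  (P_all : forall i j p, is_arc i j p -> j <= i0)
  (i0_gt0 : 0 < i0) (F_last : F i0 = N.-1) (lam_stop : lam i0.+1 = LB).

Lemma F_bounds j : 0 < j <= i0 -> j < F j < N.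
Proof. by move=> /P_arc [_ -> ->]. Qed.

Lemma F_incr j : 0 < j < i0 -> F j < F j.+1.
Proof. by move=> ji; apply: arcs_increasing (P_arc _) (P_arc _) _; lia. Qed.

Lemma F_first : F 1 = 2.
Proof.
have A := P_arc (j := 1) ltac:(lia); have [_ F1 FN sl] := A; have Q := slots_quad sl.
have b1 := T_bk (i := 1) N_gt0; rewrite lam_first in b1.
have q : qs false false (P 1) (T 3).
  by apply: (r_start loc b1 (W_consec (i := 1) ltac:(lia)) (W_consec (i := 2) ltac:(lia))); apply: Q; lia.
have [_ _ H] := sl; have [h _] := quad_inj (H 3 ltac:(lia)) q; lia.
Qed.

Lemma mark_F j : 0 < j <= i0 -> mark (lam (F j)) = mark (lam j).
Proof.
move=> ji; have [_ jF FN sl] := P_arc ji; have Q := slots_quad sl.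
have bj := T_bk (i := j) ltac:(lia); have bF := T_bk (i := F j) ltac:(lia).
by symmetry; apply: (r_mark loc (W_consec (i := j) ltac:(lia)) (W_consec (i := F j) ltac:(lia))
  (p := P j)) bj bF; apply: Q; lia.
Qed.

(** Monotonicity gives [F j < F j.+1]. Without a mark, [r_step] bounds the step by one; with a mark,
    [r_skip] makes it at least two and [r_skip_step] at most two. *)
Lemma F_step j : 0 < j < i0 ->
  F j.+1 = F j + (mark (lam j.+1)).+1 /\ (mark (lam j.+1) -> mark (lam (F j).+1) = false).
Proof.
move=> ji; have [_ jF FN sl] := P_arc (j := j) ltac:(lia).
have [_ jF' FN' sl'] := P_arc (j := j.+1) ltac:(lia).
have Q := slots_quad sl; have Q' := slots_quad sl'; have inc := F_incr ji.
have [_ _ H] := sl'.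
have b2 := T_bk (i := j.+1) ltac:(lia).
have c1 := W_consec (i := j) ltac:(lia); have c2 := W_consec (i := j.+1) ltac:(lia).
have c4 := W_consec (i := F j) ltac:(lia); have c5 := W_consec (i := (F j).+1) ltac:(lia).
have q1 : qs true true (P j) (T j) by apply: Q; lia.
have q2 : qs true false (P j) (T j.+1) by apply: Q; lia.
have q3 : qs true false (P j) (T (F j)) by apply: Q; lia.
have q4 : qs false false (P j) (T (F j).+1) by apply: Q; lia.
have q5 : qs true true (P j.+1) (T j.+1) by apply: Q'; lia.
have q6 : qs true false (P j.+1) (T j.+2) by apply: Q'; lia.
case m: (mark (lam j.+1)); last first.
  split=> //; have q := r_step loc c1 c2 c4 c5 q1 q2 q3 q4 q5 q6 b2 m.
  have [h _] := quad_inj (H (F j).+2 ltac:(lia)) q; lia.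
have b5 := T_bk (i := (F j).+1) ltac:(lia).
have [q m5] := r_skip loc c1 c2 c4 c5 q1 q2 q3 q4 q5 q6 b2 m b5; split=> //.
have [h _] := quad_inj (H (F j).+2 ltac:(lia)) q.
have c6 := W_consec (i := (F j).+2) ltac:(lia).
have q' := r_skip_step loc c1 c2 c4 c5 c6 q1 q2 q3 q4 q5 q6 b2 m.
have [h' _] := quad_inj (H (F j).+3 ltac:(lia)) q'; lia.
Qed.

(** A bootstrap: since [j.+1 <= F j], the mark at [j.+1] is already known and determines [F j.+1].
    The mark there is copied from [j.+1], and a skipped slot is unmarked. *)
Lemma marks j : 0 < j <= i0 ->
  F j = arc_end j /\ forall k, 0 < k <= F j -> mark (lam k) = marked k.
Proof.
elim: j => // j IH ji; case: (posnP j) => [->|j0].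
  split=> [|k]; first exact: F_first.
  rewrite F_first; case: k => [|[|[|k]]] //= _; first by rewrite lam_first.
  have := mark_F (j := 1) ltac:(lia); rewrite F_first lam_first => -> //.
have [EF mk] := IH ltac:(lia); have [st sk] := F_step (j := j) ltac:(lia).
have bnd := F_bounds (j := j) ltac:(lia).
have mj : mark (lam j.+1) = marked j.+1 by apply: mk; lia.
have EF' : F j.+1 = arc_end j.+1 by rewrite st arc_step // EF mj.
split=> // k kF; have [kl|kg] := leqP k (F j); first by apply: mk; lia.
have [e|ne] := eqVneq k (F j.+1).
  by rewrite e mark_F // mj EF' marked_arc.
have m : mark (lam j.+1) by move: st; case: (mark _) => //; lia.
have e : k = (F j).+1 by move: st; rewrite m; lia.
rewrite e sk // EF marked_skip //; by rewrite -mj.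
Qed.

(** Tower [i0.+1] has label [LB], so it is marked and [i0] is triangular; [arc_tri] then gives [N]
    from [F i0 = N.-1]. *)
Lemma sizes : exists r, [/\ N = tri r.+2, i0 = tri r.+1, forall j, 0 < j <= i0 -> F j = arc_end j &
  forall k, 0 < k <= N -> lam k = label r k].
Proof.
have [EF mk] := marks (j := i0) ltac:(lia).
have bnd := F_bounds (j := i0) ltac:(lia).
have : marked i0.+1 by rewrite -mk ?lam_stop //; lia.
move=> /(markedP (ltn0Sn _)) [[|r]]; first by rewrite /tri; lia.
move=> [E0]; exists r.
have EN : N = tri r.+2 by rewrite -arc_tri -E0 -EF F_last; lia.
split=> // [j ji|k kN]; first by have [] := marks ji.
rewrite /label -EN; case: eqP => [->|k1]; first exact: lam_first.
case: eqP => [->|kn]; first exact: lam_last.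
have := mk k ltac:(lia); have := lam_not_first (i := k) ltac:(lia).
have := lam_not_last (i := k) ltac:(lia).
by case: (lam k) => // _ _ <-.
Qed.

(** A reversed tower that is linked contradicts [rules_state]. *)
Lemma T_pat i : 0 < i <= N -> pat (@posR n) (valR s) (lam i) false (T i).
Proof.
move=> iN; have [[] p //] := T_bk iN.
by case: (rules_state gs p (lnk (T_bk iN))).
Qed.

(** * Reconstruction of the permutation *)

Section Sites.
Variable r : nat.
Hypotheses (EN : N = tri r.+2) (Ei : i0 = tri r.+1) (EF : forall j, 0 < j <= i0 -> F j = arc_end j)
  (El : forall k, 0 < k <= N -> lam k = label r k).

Definition place (u : site r) : 'I_n :=
  match u with inl (inl (k, t)) => T k.+1 t | inl (inr k) => W k.+1 | inr j => P j.+1 end.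

Lemma tower_bound (k : 'I_(tri r.+2)) : 0 < k.+1 <= N.
Proof. by rewrite EN /= ltn_ord. Qed.

Lemma place_slots u : 0 < kind u -> slots (place u) (xslot u) (yslot u).
Proof.
case: u => [[[k t]|k]|j] //= _.
  by apply: (W_slots (i := k.+1)); have := ltn_ord k; lia.
have jb : 0 < j.+1 <= i0 by have := ltn_ord j; lia.
by have [_ _ _] := P_arc jb; rewrite EF.
Qed.

Lemma place_left u m t : xslot u < m <= N -> place u < T m t.
Proof.
move=> mN; case: (posnP (kind u)) => [|ku].
  case: u mN => [[[k t']|//]|//] /= mN _.
  by have [] := below_lt t' t (T_below (i := k.+1) (j := m) ltac:(lia) ltac:(lia) ltac:(lia)).
have [_ /(_ t) /andP [h _]] : qs false (m <= yslot u) (place u) (T m).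
  by apply: slots_quad (place_slots ku) _ _ _; lia.
exact: h.
Qed.

Lemma place_right u m : 0 < m <= N -> m <= xslot u -> T m ord0 <= place u.
Proof.
move=> mN mu; case: (posnP (kind u)) => [|ku].
  case: u mu => [[[k t']|//]|//] /= mu _; have kN := tower_bound k.
  have [lt|e] : m < k.+1 \/ m = k.+1 by lia.
    by have [/ltnW] := below_lt ord0 t' (T_below (i := m) (j := k.+1) ltac:(lia) lt ltac:(lia)).
  subst m; case: (eqVneq t' ord0) => [-> //|t0]; apply: ltnW.
  by have [+ _] := T_pat kN ord0 t'; rewrite /posR => ->; rewrite lt0n.
have [_ /(_ ord0) /andP [h _]] : qs true (m <= yslot u) (place u) (T m).
  by apply: slots_quad (place_slots ku) _ _ _; lia.
exact: ltnW.
Qed.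

Lemma place_below u m t : yslot u < m <= N -> s (place u) < s (T m t).
Proof.
move=> mN; case: (posnP (kind u)) => [|ku].
  case: u mN => [[[k t']|//]|//] /= mN _.
  by have [] := below_lt t' t (T_below (i := k.+1) (j := m) ltac:(lia) ltac:(lia) ltac:(lia)).
have [_ /(_ t) /andP [_ h]] : qs (m <= xslot u) false (place u) (T m).
  by apply: slots_quad (place_slots ku) _ _ _; lia.
exact: h.
Qed.

Lemma place_above u m : 0 < m <= N -> m <= yslot u -> s (T m (bot (lam m) false)) <= s (place u).
Proof.
move=> mN mu; case: (posnP (kind u)) => [|ku].
  case: u mu => [[[k t']|//]|//] /= mu _; have kN := tower_bound k.
  have [lt|e] : m < k.+1 \/ m = k.+1 by lia.
    by have [_ /ltnW] := below_lt (bot (lam m) false) t'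
      (T_below (i := m) (j := k.+1) ltac:(lia) lt ltac:(lia)).
  subst m; case: (classic (t' = bot (lam k.+1) false)) => [-> //|t0]; apply: ltnW.
  have [_] := T_pat kN (bot (lam k.+1) false) t'; rewrite /valR => ->; exact: beta_bot.
have [_ /(_ (bot (lam m) false)) /andP [_ h]] : qs (m <= xslot u) true (place u) (T m).
  by apply: slots_quad (place_slots ku) _ _ _; lia.
exact: ltnW.
Qed.

Lemma xslot_bound (u : site r) : xslot u <= N.
Proof.
have := site_cases u; rewrite EN => -[[k [t ->]]|[_ e ? _ _]|[_ _ _ [? _] _]]; last 2 first.
- lia.
- lia.
by rewrite /= ltn_ord.
Qed.

Lemma yslot_bound (u : site r) : yslot u <= N.
Proof.
case: u => [[[k t]|k]|j] /=; rewrite EN ?ltn_ord //; first by have := ltn_ord k; lia.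
have := ltn_ord j; have := F_bounds (j := i0) ltac:(lia); lia.
Qed.

Lemma place_right_loose u m t : 0 < kind u -> 0 < m <= N -> m <= xslot u -> T m t < place u.
Proof.
move=> ku mN mu; have [_ /(_ t) /andP [h _]] : qs true (m <= yslot u) (place u) (T m).
  by apply: slots_quad (place_slots ku) _ _ _; lia.
exact: h.
Qed.

Lemma place_above_loose u m t : 0 < kind u -> 0 < m <= N -> m <= yslot u -> s (T m t) < s (place u).
Proof.
move=> ku mN mu; have [_ /(_ t) /andP [_ h]] : qs (m <= xslot u) true (place u) (T m).
  by apply: slots_quad (place_slots ku) _ _ _; lia.
exact: h.
Qed.

(** Sites in different slots are separated by the leftmost point of tower [xslot v]. Within one slot
    the order is tower, link, arc, the last comparison being [r_xorder]. *)
Lemma place_x u v : xpos u < xpos v -> place u < place v.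
Proof.
have xb := xslot_bound v; case: (ltnP (xslot u) (xslot v)) => [lt _|le].
  by apply: leq_trans (place_left ord0 _) (place_right _ (leqnn _)); lia.
case: (site_cases u) => [[k [t Eu]]|[ku yu yN xu _]|[ku xsu yu [xl xu] _]];
case: (site_cases v) => [[k' [t' Ev]]|[kv yv yN' xv _]|[kv xsv yv [xl' xv] _]].
- subst u v; move: le => /= le; rewrite /xpos /= => lt.
  have := ltn_ord t; have := ltn_ord t' => t7 t7'.
  have e : k = k' by apply: val_inj => /=; lia.
  subst k'; have [+ _] := T_pat (tower_bound k) t t'; rewrite /posR => ->; lia.
- subst u; move: le => /= le; rewrite {1}/xpos /= xv => lt; apply: place_right_loose; rewrite ?kv //.
  + exact: tower_bound.
  + by lia.
- subst u; move: le => /= le; rewrite {1}/xpos /= xv => lt; apply: place_right_loose; rewrite ?kv //.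
  + exact: tower_bound.
  + by lia.
- by subst v; move: le; rewrite xu /xpos /=; have := ltn_ord t'; lia.
- by rewrite xu xv; lia.
- rewrite xu xv => lt; have e : xslot u = xslot v by lia.
  have su := slots_quad (place_slots (u := u) ltac:(lia)).
  have sv := slots_quad (place_slots (u := v) ltac:(lia)).
  have av := arc_gt (yslot v); rewrite -EN in xl'.
  have c := W_consec (i := xslot u) ltac:(lia).
  by apply: (r_xorder loc c); [apply: su|apply: su|apply: sv|apply: sv]; lia.
- by subst v; move: le; rewrite xu /xpos /=; have := ltn_ord t'; lia.
- by rewrite xu xv; lia.
by rewrite xu xv; lia.
Qed.

(** As for [place_x], with the lowest point [bot] of a tower in place of its leftmost point and with
    [r_yorder]. *)
Lemma place_y u v : ypos u < ypos v -> s (place u) < s (place v).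
Proof.
have yb := yslot_bound v; case: (ltnP (yslot u) (yslot v)) => [lt _|le].
  by apply: leq_trans (place_below _ _) (place_above _ (leqnn _)); lia.
have b7 i t := beta_lt7 (label r i) false t.
case: (site_cases u) => [[k [t Eu]]|[ku yu yN _ xu]|[ku xsu yu [xl _] xu]];
case: (site_cases v) => [[k' [t' Ev]]|[kv yv yN' _ xv]|[kv xsv yv [xl' _] xv]].
- subst u v; move: le => /= le; rewrite /ypos /= => lt.
  have := b7 k.+1 t; have := b7 k'.+1 t' => t7 t7'.
  have e : k = k' by apply: val_inj => /=; lia.
  subst k'; have [_] := T_pat (tower_bound k) t t'; rewrite /valR => ->.
  by rewrite El ?tower_bound //; lia.
- subst u; move: le => /= le; rewrite {1}/ypos /= xv => lt; apply: place_above_loose; rewrite ?kv //.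
  + exact: tower_bound.
  + by have := b7 k.+1 t; lia.
- subst u; move: le => /= le; rewrite {1}/ypos /= xv => lt; apply: place_above_loose; rewrite ?kv //.
  + exact: tower_bound.
  + by have := b7 k.+1 t; lia.
- by subst v; move: le; rewrite xu /ypos /=; have := b7 k'.+1 t'; lia.
- by rewrite xu xv; lia.
- rewrite xu xv => lt; have e : yslot u = yslot v by lia.
  have su := slots_quad (place_slots (u := u) ltac:(lia)).
  have sv := slots_quad (place_slots (u := v) ltac:(lia)).
  have av := arc_gt (yslot v); rewrite -EN in xl'.
  have c := W_consec (i := yslot u) ltac:(lia).
  by apply: (r_yorder (rules_order gs) c); [apply: su|apply: su|apply: sv|apply: sv]; lia.
- by subst v; move: le; rewrite xu /ypos /=; have := b7 k'.+1 t'; lia.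
- by rewrite xu xv; lia.
by rewrite xu xv; lia.
Qed.

Lemma place_layout : layout s (@xpos r) (@ypos r) place.
Proof.
have ex u v : (place u < place v) = (xpos u < xpos v).
  case: (ltngtP (xpos u) (xpos v)) => [/place_x //|/place_x lt|/xpos_inj ->]; last by rewrite ltnn.
  by apply/negbTE; rewrite -leqNgt ltnW.
have ey u v : (s (place u) < s (place v)) = (ypos u < ypos v).
  case: (ltngtP (ypos u) (ypos v)) => [/place_y //|/place_y lt|/ypos_inj ->]; last by rewrite ltnn.
  by apply/negbTE; rewrite -leqNgt ltnW.
split=> //.
have pi : injective place.
  move=> u v e; apply: xpos_inj.
  by case: (ltngtP (xpos u) (xpos v)) => // /place_x; rewrite e ltnn.
apply: inj_card_bij pi _; rewrite -cardsT.
have surj z : z \in codom place.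
  apply/codomP; case: (point_cases z) => [[i [t [iN ->]]]|[i iN ->]|[i [j A]]].
  - have i1 : i.-1 < tri r.+2 by lia.
    by exists (inl (inl (Ordinal i1, t))); rewrite /= prednK //; lia.
  - have i1 : i.-1 < (tri r.+2).-1 by lia.
    by exists (inl (inr (Ordinal i1))); rewrite /= prednK //; lia.
  have ji := P_all A; have [j0 _ _ _] := A; have j1 : j.-1 < tri r.+1 by lia.
  exists (inr (Ordinal j1)); rewrite /= prednK //.
  exact: arc_row A (P_arc (j := j) ltac:(lia)).
have <- : #|codom place| = #|[set: 'I_n]|.
  by rewrite cardsT; apply: eq_card => z; rewrite surj inE.
by apply: leq_trans (card_size _) _; rewrite size_codom.
Qed.

End Sites.
End ArcFunction.
End Arcs.
End Towers.

Lemma model_layout : exists r (e : site r -> 'I_n), layout s (@xpos r) (@ypos r) e.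
Proof.
have [N [T [lam [N0 Tbk bkT Tblw]]]] := towers_exist.
have W_ex i : exists w, 0 < i < N -> csc (T i) (T i.+1) w.
  case: (classic (0 < i < N)) => [iN|no]; last by exists (T 1 ord0).
  by have [w [c _]] := successor N0 Tbk bkT Tblw iN; exists w.
have [W Wc] := fun_choice W_ex.
have [i0 [p0 [A0 lam0 all_arcs]]] := last_arc N0 Tbk bkT Tblw Wc.
have [j0 ji i0N _] := A0.
pose arcs := is_arc N T.
(* The column slot and the arc are chosen together; [(0, p0)] is a default outside the range of
   rows. *)
have P_ex j : exists ip : nat * 'I_n, 0 < j <= i0 -> arcs ip.1 j ip.2.
  case: (classic (0 < j <= i0)) => [jN|no]; last by exists (0, p0).
  have [|[i [p A]]] := all_arcs j ltac:(lia); first by lia.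
  by exists (i, p).
have [FP HFP] := fun_choice P_ex.
(* An arc from a row after [i0] would end beyond column slot [N - 1]. *)
have P_all i j p : arcs i j p -> j <= i0.
  move=> A; rewrite leqNgt; apply/negP => lt.
  have := arcs_increasing N0 Tblw Wc A0 A lt.
  by have [_ _ iN _] := A; lia.
have F_last : (FP i0).1 = N.-1.
  have A1 := HFP i0 ltac:(lia); have e := arc_row N0 Wc A0 A1.
  by rewrite -e in A1; have [-> _] := arc_point N0 A0 A1.
have HF j : 0 < j <= i0 -> is_arc N T (FP j).1 j (FP j).2 by exact: HFP.
have [r [EN Ei EF El]] := sizes (F := fun j => (FP j).1) (P := fun j => (FP j).2)
  N0 Tbk bkT Tblw Wc HF j0 F_last lam0.
exists r; eexists.
exact: (place_layout (F := fun j => (FP j).1) (P := fun j => (FP j).2)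
  N0 Tbk bkT Tblw Wc HF P_all j0 F_last EN Ei EF El).
Qed.

End Model.

(** * Conclusion *)

(** Splits off one binary digit when [P] is a power of 2. *)
Lemma modn_double (h P : nat) : h %% (2 * P) = odd (h %/ P) * P + h %% P.
Proof.
case: (posnP P) => [->|P0]; first by rewrite !muln0 !modn0.
rewrite {1}(divn_eq h P) -{1}(odd_double_half (h %/ P)) mulnDl -muln2 -mulnA.
rewrite [_ + _ * _]addnC -addnA modnMDl modn_small //.
by have := ltn_pmod h P0; case: (odd _); lia.
Qed.

(** Lifting one binary digit at a time: replacing [S] by [S + 2 ^ K] adds an odd multiple of
    [2 ^ K], because the linear coefficient 7 is odd and 18 is even. *)
Lemma quadratic_residues (K m B : nat) :
  exists2 S, B <= S & 18 * S ^ 2 + 7 * S = m %[mod 2 ^ K].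
Proof.
elim: K => [|K [S BS E]]; first by exists B; rewrite // !modn1.
pose h S := 18 * S ^ 2 + 7 * S; rewrite -/(h S) in E.
case: (eqVneq (odd (h S %/ 2 ^ K)) (odd (m %/ 2 ^ K))) => [e|ne].
  by exists S => //; rewrite -/(h S) expnS !modn_double e E.
exists (S + 2 ^ K); first by lia.
have P0 : 0 < 2 ^ K by rewrite expn_gt0.
have -> : 18 * (S + 2 ^ K) ^ 2 + 7 * (S + 2 ^ K) = (36 * S + 18 * 2 ^ K + 7) * 2 ^ K + h S.
  by rewrite /h !expnS !expn0 !muln1; move: (2 ^ K) => P; lia.
rewrite expnS !modn_double modnMDl E divnMDl //.
have -> : 36 * S + 18 * 2 ^ K + 7 = (18 * S + 9 * 2 ^ K + 3).*2.+1 by lia.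
rewrite addSn oddS oddD odd_double.
by move: ne; case: (odd _); case: (odd _).
Qed.

Definition model_size (r : nat) : nat := #|site r|.

Lemma model_size_step r : model_size r.+1 = model_size r + 9 * r + 26.
Proof. by rewrite /model_size !card_site /tri -/tri; lia. Qed.

(** The size plus one is [8 * tri r.+2 + tri r.+1]; an even [r] clears the denominator 2 in this
    quadratic. *)
Lemma model_size_even S : 0 < S -> (model_size (2 * S.-1)).+1 = 18 * S ^ 2 + 7 * S.
Proof.
case: S => // S _ /=; rewrite /model_size card_site.
have := tri_double (2 * S).+2; rewrite -[tri (2 * S).+2]/(tri (2 * S).+1 + (2 * S).+2).
by rewrite !expnS expn0; nia.
Qed.

Lemma model_size_gap d r r' : d <= r -> r' <> r ->
  model_size r' + d < model_size r \/ model_size r + d < model_size r'.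
Proof.
have mono p q : p < q -> model_size p + 9 * q + 17 <= model_size q.
  elim: q => // q IH; rewrite ltnS leq_eqVlt => /orP [/eqP ->|/IH]; rewrite model_size_step; lia.
move=> dr ne; have [lt|lt] : r' < r \/ r < r' by lia.
  by left; have := mono _ _ lt; lia.
by right; have := mono _ _ lt; lia.
Qed.

(** There is at most one model of each size: the size determines [r], and [r] determines the
    layout. *)
Lemma odd_card_model n : odd #|[set s : 'S_n | asb (model s)]| <-> exists r, n = model_size r.
Proof.
split=> [|[r En]].
  case: (set_0Vmem [set s : 'S_n | asb (model s)]) => [->|[s]]; first by rewrite cards0.
  rewrite inE => /asbP /model_layout [r [e [be _ _]]] _; exists r.
  by rewrite /model_size (bij_eq_card be) card_ord.
subst n; have [s ms] := model_exists r.
suff -> : [set s : 'S_(model_size r) | asb (model s)] = [set s] by rewrite cards1.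
apply/setP => s'; rewrite !inE; apply/asbP/eqP => [ms'|-> //].
have [q [e le]] := model_layout ms; have [q' [e' le']] := model_layout ms'.
have size_q t (u : 'S_(model_size r)) (f : site t -> 'I_(model_size r)) :
    layout u (@xpos t) (@ypos t) f -> t = r.
  case=> bf _ _; have := bij_eq_card bf; rewrite card_ord -/(model_size t) => E.
  by apply: NNPP => ne; have := model_size_gap (leq0n r) ne; rewrite E; lia.
have Eq := size_q _ _ _ le; have Eq' := size_q _ _ _ le'; subst q q'.
by rewrite (layout_unique le le').
Qed.

Lemma odd_C_count n : 80 <= n -> odd (C_count bad_patterns n) <-> exists r, n = model_size r.
Proof.
move=> n80; rewrite -odd_card_model -odd_card_good; last exact: leq_trans n80.
rewrite /C_count; suff -> : [set s : 'S_n | avoids s bad_patterns] = [set s | asb (good s)] by [].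
apply/setP => s; rewrite !inE; apply/idP/asbP => /(avoids_bad_patterns s n80) //.
Qed.

Lemma bad_patterns_not_P_recursive : ~ P_recursive (fun n => Posz (C_count bad_patterns n)).
Proof.
apply: (@isolated_odd_not_P_recursive _ (fun n => exists r, n = model_size r) 80).
  by move=> n n80 /=; apply: odd_C_count.
(* The target is [m.+1] because the quadratic is the size plus one. The bound on [S] makes it
   positive and puts both the size above [B] and the index [2 * S.-1] above [d]. *)
move=> d K m B; have [S BS E] := quadratic_residues K m.+1 (B + d).+1.
exists (model_size (2 * S.-1)); split.
- have := model_size_even (S := S) ltac:(lia); nia.
- by exists (2 * S.-1).
- by apply/eqP; rewrite -(eqn_modDr 1) !addn1 model_size_even ?E //; lia.
by move=> n' [r' ->] ne; apply: model_size_gap; [lia | move=> e; apply: ne; rewrite e].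
Qed.

Theorem theorem1p2 :
  (exists F : {set 'S_80}, ~ P_recursive (fun n => Posz (C_count F n))) /\
  ~ (forall (k : nat) (F : {set 'S_k}), P_recursive (fun n => Posz (C_count F n))).
Proof.
split; first by exists bad_patterns; apply: bad_patterns_not_P_recursive.
by move=> /(_ _ bad_patterns); apply: bad_patterns_not_P_recursive.
Qed.
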